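(* Let $\{(x^k,z^k,y^k,\pi^k,\xi^k,\eta^k,\zeta^k,\varphi_k)\}_{k\ge 0}$ be generated by the Master Algorithm described in the context, applied to the convex quadratic program $\min\{f(x): Ax\ge b,\ Cx=d\}$, under the standing assumptions, with a base iteration and a penalty-parameter update satisfying the requirements listed in the context. Then (i) $\varphi_k$ is eventually constant, and (ii) $(z^k,y^k)\to 0$ as $k\to\infty$ and $x^k$ converges to the set of solutions of $$(\tilde P)\qquad \min_{x\in\mathbb R^n} f(x)\ \text{ s.t. } Ax\ge b,\ Cx\ge d,\ -Cx\ge -d,$$ that is, the distance from $x^k$ to that solution set tends to $0$.
   Context: Problem. $n\ge p\ge 0$, $m\ge0$, $m+p>0$; $H\in\mathbb R^{n\times n}$ symmetric positive semidefinite, $c\in\mathbb R^n$, $A\in\mathbb R^{m\times n}$, $b\in\mathbb R^m$, $C\in\mathbb R^{p\times n}$, $d\in\mathbb R^p$; $f(x)=\frac12x^THx+c^Tx$. Inequalities between vectors are componentwise; $\mathbf 1$ is the all-ones vector; $\|\cdot\|$ is an arbitrary norm; for a vector $v$, the capital letter $V$ denotes $\mathrm{diag}(v)$; $[u;v]$ is vertical concatenation. $(P)$: minimize $f(x)$ subject to $Ax\ge b$, $Cx=d$. Its dual has constraints $Hx+c-A^T\pi-C^T\omega=0$, $\pi\ge0$, $\omega\in\mathbb R^p$ free. Standing assumptions. (1) There is $x$ with $Ax>b$, $Cx=d$; there is $(x,\pi,\omega)$ with $Hx+c-A^T\pi-C^T\omega=0$, $\pi>0$; and the (nonempty) optimal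 solution set of $(P)$ is bounded. (2) $C$ has full row rank and $[H;A;C]$ has full column rank. Augmented problem. For $\varphi>0$, $(\tilde P_\varphi)$: minimize $\tilde f_\varphi(x,z,y):=f(x)+\varphi\mathbf 1^T[z;y]$ over $(x,z,y)\in\mathbb R^n\times\mathbb R^m\times\mathbb R^p$ subject to $Ax+z\ge b$, $z\ge0$, $Cx+y\ge d$, $-Cx+y\ge -d$. This is an inequality-constrained CQP in $(x,z,y)$; multipliers of the four groups of constraints are denoted $\pi,\xi,\eta,\zeta$ respectively. Base iteration. A procedure (possibly with internal state) which, applied repeatedly to an inequality-constrained CQP ''minimize $q(u)=\frac12u^TQu+g^Tu$ s.t. $Mu\ge h$'' ($Q$ symmetric positive semidefinite), produces a primal sequence $\{u^\ell\}_{\ell\ge0}$ with an associated dual sequence $\{\lambda^\ell\}$, $\lambda^\ell\ge0$, such that: (BI1) at least one of the following holds: (i) $u^{\ell+1}$ is feasible whenever $u^\ell$ is feasible; (ii) $u^{\ell+1}$ is strictly feasible ($Mu^{\ell+1}>h$) whenever $u^\ell$ is strictly feasible; (BI2) for every $\ell_0\ge0$ there is $\ell>\ell_0$ with $q(u^\ell)\le q(u^{\ell_0})$; (BI3) with $\hat K:=\{k>0: q(u^k)\le q(u^\ell)\ \forall \ell<k\}$ (an infinite set), if $\{u^k\}_{k\in\hat K}$ is bounded then $\max\{\|\mathrm{diag}(Mu^k-h)\lambda^k\|,\|Qu^k+g-M^T\lambda^k\|\}\to0$ as $k\to\infty$, $k\in\hat K$. Master Algorithm. Initialization: $(x^0,z^0,y^0)$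 strictly feasible for the constraints of $(\tilde P_\varphi)$ (merely feasible is allowed if (BI1)(i) holds), $(\pi^0,\xi^0,\eta^0,\zeta^0)\ge0$, $\varphi_0>0$. Iteration $k=0,1,2,\dots$: the penalty-parameter update, from $\varphi_k$ and the current primal and dual iterates, returns $\varphi_{k+1}\ge\varphi_k$; then the base iteration is applied to $(\tilde P_{\varphi_{k+1}})$ from $(x^k,z^k,y^k)$, repeatedly, until it returns a point whose $\tilde f_{\varphi_{k+1}}$-value is at most $\tilde f_{\varphi_{k+1}}(x^k,z^k,y^k)$; this point is $(x^{k+1},z^{k+1},y^{k+1})$ and its associated dual vector is $(\pi^{k+1},\xi^{k+1},\eta^{k+1},\zeta^{k+1})\ge0$. As long as the penalty parameter stays constant, the successive base iterates form a single run of the base iteration on that augmented problem. No stopping criterion is used, so the sequences are infinite; in particular $\tilde f_{\varphi_k}(x^k,z^k,y^k)\le\tilde f_{\varphi_k}(x^{k-1},z^{k-1},y^{k-1})$ for all $k\ge1$. Slacks: $s^k=Ax^k+z^k-b$, $t_+^k=Cx^k+y^k-d$, $t_-^k=-Cx^k+y^k+d$. Requirements on the penalty-parameter update. Let $G_1^k:=(S^k\pi^k,Z^k\xi^k,T_+^k\eta^k,T_-^k\zeta^k)$, $G_2^k:=(Hx^k+c-A^T\pi^k-C^T(\eta^k-\zeta^k),\ \pi^k+\xi^k-\varphi_k\mathbf 1,\ \eta^k+\zeta^k-\varphi_k\mathbf 1)$, $G_3^k:=(Hx^k+c-A^T\pi^k-C^T(\eta^k-\zeta^k))^Tx^k$.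 (PU1) $\{\varphi_k\}$ is positive, nondecreasing, and either eventually constant or grows without bound. (PU2) If $\{(z^k,y^k)\}$ is unbounded then $\varphi_k\to\infty$. (PU3) If $\varphi_k$ is eventually constant, equal to $\hat\varphi$, and $\|G_1^k\|,\|G_2^k\|,|G_3^k|\to0$, then $\hat\varphi>\liminf_k\|[\pi^k;\eta^k-\zeta^k]\|_\infty$. (PU4) If $\varphi_k\to\infty$ and $\{(z^k,y^k)\}$ is bounded, then there is an infinite index set $K$ such that $G_1^k$, $G_2^k$, $G_3^k$ and $\varphi_k/\max\{1,\|[\pi^k;\eta^k-\zeta^k]\|\}$ are bounded on $K$. *)

(* Defs.v *)
From HB Require Import structures.
From mathcomp Require Import all_boot all_order all_algebra.
From mathcomp Require Import all_classical all_reals all_analysis.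

Set Implicit Arguments.
Unset Strict Implicit.
Unset Printing Implicit Defensive.

Import Order.TTheory GRing.Theory Num.Theory.
Import numFieldNormedType.Exports.

Local Open Scope classical_set_scope.
Local Open Scope ring_scope.

Definition vle (R : realType) d (u v : 'cV[R]_d) : Prop :=
  forall i, u i 0 <= v i 0.

Definition vlt (R : realType) d (u v : 'cV[R]_d) : Prop :=
  forall i, u i 0 < v i 0.

Definition dotv (R : realType) d (u v : 'cV[R]_d) : R := (u^T *m v) 0 0.

Definition ones (R : realType) d : 'cV[R]_d := const_mx 1.

Definition dgmx (R : realType) d (v : 'cV[R]_d) : 'M[R]_d := diag_mx v^T.

(* An arbitrary norm, chosen independently in each dimension; not to be confused
   with the library norm `|v| on matrices, which is the max norm. *)
Record vnorm (R : realType) := VNorm {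
  vnorm_fun :> forall d, 'cV[R]_d -> R;
  vnormD : forall d (u v : 'cV[R]_d),
    vnorm_fun (u + v) <= vnorm_fun u + vnorm_fun v;
  vnormZ : forall d (a : R) (v : 'cV[R]_d),
    vnorm_fun (a *: v) = `|a| * vnorm_fun v;
  vnorm_eq0 : forall d (v : 'cV[R]_d), vnorm_fun v = 0 -> v = 0 }.

(* Extended-real valued, so that the distance to the empty set is +oo. *)
Definition vdist (R : realType) (N : vnorm R) d (x : 'cV[R]_d)
    (A : set 'cV[R]_d) : \bar R :=
  ereal_inf [set (N d (x - s))%:E | s in A].

Definition psdmx (R : realType) d (Q : 'M[R]_d) : Prop :=
  Q^T = Q /\ forall x : 'cV[R]_d, 0 <= dotv x (Q *m x).

Definition quadf (R : realType) d (Q : 'M[R]_d) (g u : 'cV[R]_d) : R :=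
  2^-1 * dotv u (Q *m u) + dotv g u.

(** * Inequality-constrained quadratic programs: min quadf Q g s.t. M u >= h *)

Record iqp (R : realType) (N L : nat) := Iqp {
  iqpQ : 'M[R]_N;
  iqpg : 'cV[R]_N;
  iqpM : 'M[R]_(L, N);
  iqph : 'cV[R]_L }.

Definition iqp_obj (R : realType) N L (P : iqp R N L) (u : 'cV[R]_N) : R :=
  quadf (iqpQ P) (iqpg P) u.

Definition iqp_slack (R : realType) N L (P : iqp R N L) (u : 'cV[R]_N) :
  'cV[R]_L := iqpM P *m u - iqph P.

Definition iqp_feasible (R : realType) N L (P : iqp R N L) (u : 'cV[R]_N) :=
  vle (iqph P) (iqpM P *m u).

Definition iqp_sfeasible (R : realType) N L (P : iqp R N L) (u : 'cV[R]_N) :=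
  vlt (iqph P) (iqpM P *m u).

Definition iqp_sol (R : realType) N L (P : iqp R N L) : set 'cV[R]_N :=
  [set u | iqp_feasible P u /\
           forall v, iqp_feasible P v -> iqp_obj P u <= iqp_obj P v].

(** * Base iterations *)

(* A procedure, possibly nondeterministic and with hidden internal state, is
   given by its runs: [run P u lam] means that, when applied repeatedly to P
   starting from the primal point [u 0], it can produce the primal sequence u
   with associated dual sequence lam. *)
Definition procedure (R : realType) (N L : nat) :=
  iqp R N L -> (nat -> 'cV[R]_N) -> (nat -> 'cV[R]_L) -> Prop.

Definition keeps_feasible (R : realType) N L (run : procedure R N L) : Prop :=
  forall P u lam, psdmx (iqpQ P) -> run P u lam ->
  forall l, iqp_feasible P (u l) -> iqp_feasible P (u l.+1).

Definition keeps_sfeasible (R : realType) N L (run : procedure R N L) : Prop :=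
  forall P u lam, psdmx (iqpQ P) -> run P u lam ->
  forall l, iqp_sfeasible P (u l) -> iqp_sfeasible P (u l.+1).

Definition record_indices (R : realType) N L (P : iqp R N L)
    (u : nat -> 'cV[R]_N) : set nat :=
  [set k | (0 < k)%N /\
           forall l, (l < k)%N -> iqp_obj P (u k) <= iqp_obj P (u l)].

Definition kkt_residual (R : realType) (nrm : vnorm R) N L (P : iqp R N L)
    (u : 'cV[R]_N) (lam : 'cV[R]_L) : R :=
  Num.max (nrm L (dgmx (iqp_slack P u) *m lam))
          (nrm N (iqpQ P *m u + iqpg P - (iqpM P)^T *m lam)).

Record base_iteration (R : realType) (nrm : vnorm R) N L
    (run : procedure R N L) : Prop := BaseIteration {
  BI_dual : forall P u lam, psdmx (iqpQ P) -> run P u lam ->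
    forall l, vle 0 (lam l);
  BI1 : keeps_feasible run \/ keeps_sfeasible run;
  BI2 : forall P u lam, psdmx (iqpQ P) -> run P u lam ->
    forall l0, exists2 l, (l0 < l)%N & iqp_obj P (u l) <= iqp_obj P (u l0);
  BI3 : forall P u lam, psdmx (iqpQ P) -> run P u lam ->
    [bounded nrm N (u k) | k in record_indices P u] ->
    (fun k => kkt_residual nrm P (u k) (lam k))
      @ within (record_indices P u) \oo --> (0 : R) }.

(** * The convex quadratic program (P) *)

Record cqp (R : realType) (n m p : nat) := Cqp {
  qH : 'M[R]_n;
  qc : 'cV[R]_n;
  qA : 'M[R]_(m, n);
  qb : 'cV[R]_m;
  qC : 'M[R]_(p, n);
  qd : 'cV[R]_p }.

Definition cqp_obj (R : realType) n m p (D : cqp R n m p) (x : 'cV[R]_n) : R :=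
  quadf (qH D) (qc D) x.

Definition cqp_feasible (R : realType) n m p (D : cqp R n m p)
    (x : 'cV[R]_n) : Prop :=
  vle (qb D) (qA D *m x) /\ qC D *m x = qd D.

Definition cqp_sol (R : realType) n m p (D : cqp R n m p) : set 'cV[R]_n :=
  [set x | cqp_feasible D x /\
           forall x', cqp_feasible D x' -> cqp_obj D x <= cqp_obj D x'].

Record standing_assumptions (R : realType) (nrm : vnorm R) n m p
    (D : cqp R n m p) : Prop := StandingAssumptions {
  primal_sfeasible : exists x, vlt (qb D) (qA D *m x) /\ qC D *m x = qd D;
  dual_sfeasible : exists (x : 'cV[R]_n) (pi : 'cV[R]_m) (omega : 'cV[R]_p),
    qH D *m x + qc D - (qA D)^T *m pi - (qC D)^T *m omega = 0 /\ vlt 0 pi;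
  sol_nonempty : cqp_sol D !=set0;
  sol_bounded : [bounded nrm n x | x in cqp_sol D];
  C_full_row_rank : \rank (qC D) = p;
  HAC_full_col_rank : \rank (col_mx (qH D) (col_mx (qA D) (qC D))) = n }.

(* The problem (P~): each equality is split into two inequalities. *)
Definition split_qp (R : realType) n m p (D : cqp R n m p) :
    iqp R n (m + (p + p)) :=
  Iqp (qH D) (qc D)
      (col_mx (qA D) (col_mx (qC D) (- qC D)))
      (col_mx (qb D) (col_mx (qd D) (- qd D))).

(* The problem (P~_phi), in the variable [x; z; y]; see aug_objE, aug_feasibleE. *)
Definition aug_qp (R : realType) n m p (D : cqp R n m p) (phi : R) :
    iqp R (n + (m + p)) (m + (m + (p + p))) :=
  Iqp (block_mx (qH D) 0 0 0)
      (col_mx (qc D) (phi *: ones R (m + p)))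
      (col_mx (row_mx (qA D)     (row_mx 1%:M 0))
      (col_mx (row_mx 0          (row_mx 1%:M 0))
      (col_mx (row_mx (qC D)     (row_mx 0 1%:M))
              (row_mx (- qC D)   (row_mx 0 1%:M)))))
      (col_mx (qb D) (col_mx 0 (col_mx (qd D) (- qd D)))).

(** * Iterates of the master algorithm *)

Record iterate (R : realType) (n m p : nat) := Iterate {
  ix : 'cV[R]_n;
  iz : 'cV[R]_m;
  iy : 'cV[R]_p;
  ipi : 'cV[R]_m;
  ixi : 'cV[R]_m;
  ieta : 'cV[R]_p;
  izeta : 'cV[R]_p }.

Definition primal (R : realType) n m p (w : iterate R n m p) :
  'cV[R]_(n + (m + p)) := col_mx (ix w) (col_mx (iz w) (iy w)).

Definition dual (R : realType) n m p (w : iterate R n m p) :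
    'cV[R]_(m + (m + (p + p))) :=
  col_mx (ipi w) (col_mx (ixi w) (col_mx (ieta w) (izeta w))).

Definition aug_vars (R : realType) n m p (w : iterate R n m p) :
  'cV[R]_(m + p) := col_mx (iz w) (iy w).

(* The multipliers [pi; eta - zeta] of the constraints of (P). *)
Definition multipliers (R : realType) n m p (w : iterate R n m p) :
  'cV[R]_(m + p) := col_mx (ipi w) (ieta w - izeta w).

Section Residuals.
Context (R : realType) (n m p : nat) (D : cqp R n m p).
Implicit Types (w : iterate R n m p) (phi : R).

Definition slack_s w : 'cV[R]_m := qA D *m ix w + iz w - qb D.
Definition slack_tp w : 'cV[R]_p := qC D *m ix w + iy w - qd D.
Definition slack_tm w : 'cV[R]_p := - (qC D *m ix w) + iy w + qd D.

Definition lagr_grad w : 'cV[R]_n :=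
  qH D *m ix w + qc D - (qA D)^T *m ipi w - (qC D)^T *m (ieta w - izeta w).

Definition G1 w : 'cV[R]_(m + (m + (p + p))) :=
  col_mx (dgmx (slack_s w) *m ipi w)
  (col_mx (dgmx (iz w) *m ixi w)
  (col_mx (dgmx (slack_tp w) *m ieta w)
          (dgmx (slack_tm w) *m izeta w))).

Definition G2 phi w : 'cV[R]_(n + (m + p)) :=
  col_mx (lagr_grad w)
  (col_mx (ipi w + ixi w - phi *: ones R m)
          (ieta w + izeta w - phi *: ones R p)).

Definition G3 w : R := dotv (lagr_grad w) (ix w).
End Residuals.

(** * Requirements on the penalty parameters *)

Record penalty_requirements (R : realType) (nrm : vnorm R) n m p
    (D : cqp R n m p) (w : nat -> iterate R n m p) (phi : nat -> R) : Prop :=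
  PenaltyRequirements {
  PU1 : [/\ forall k, 0 < phi k,
            forall k, phi k <= phi k.+1 &
            (exists phihat, \forall k \near \oo, phi k = phihat) \/
            phi @ \oo --> +oo];
  PU2 : ~ [bounded nrm _ (aug_vars (w k)) | k in [set: nat]] ->
    phi @ \oo --> +oo;
  (* `| _ | below is the max norm on column vectors. *)
  PU3 : forall phihat, (\forall k \near \oo, phi k = phihat) ->
    (fun k => nrm _ (G1 D (w k))) @ \oo --> (0 : R) ->
    (fun k => nrm _ (G2 D (phi k) (w k))) @ \oo --> (0 : R) ->
    (fun k => `|G3 D (w k)|) @ \oo --> (0 : R) ->
    (limn_einf (fun k => `|multipliers (w k)|%:E) < phihat%:E)%E;
  PU4 : phi @ \oo --> +oo ->
    [bounded nrm _ (aug_vars (w k)) | k in [set: nat]] ->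
    exists K : set nat, infinite_set K /\
      [/\ [bounded nrm _ (G1 D (w k)) | k in K],
          [bounded nrm _ (G2 D (phi k) (w k)) | k in K],
          [bounded G3 D (w k) | k in K] &
          [bounded phi k / Num.max 1 (nrm _ (multipliers (w k))) | k in K]] }.

(** * The master algorithm *)

(* Iteration k follows the run [ru k], [rl k] of the base iteration on
   (P~_phi_{k+1}), from its index [a k] up to the first later index [e k] at
   which the objective does not exceed its value at the current iterate.  The
   run of the previous iteration is continued when the penalty parameter is
   unchanged, and otherwise a new one is begun at the current primal iterate. *)
Definition inner_iterations (R : realType) n m p (D : cqp R n m p)
    (run : procedure R (n + (m + p)) (m + (m + (p + p))))
    (w : nat -> iterate R n m p) (phi : nat -> R) : Prop :=
  exists (ru : nat -> nat -> 'cV[R]_(n + (m + p)))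
         (rl : nat -> nat -> 'cV[R]_(m + (m + (p + p))))
         (a e : nat -> nat),
    [/\ forall k, run (aug_qp D (phi k.+1)) (ru k) (rl k),
        a 0%N = 0%N,
        forall k, phi k.+2 = phi k.+1 ->
          [/\ ru k.+1 = ru k, rl k.+1 = rl k & a k.+1 = e k],
        forall k, phi k.+2 <> phi k.+1 -> a k.+1 = 0%N &
        forall k, let q := iqp_obj (aug_qp D (phi k.+1)) in
          [/\ (a k < e k)%N,
              ru k (a k) = primal (w k),
              ru k (e k) = primal (w k.+1) /\ rl k (e k) = dual (w k.+1),
              q (primal (w k.+1)) <= q (primal (w k)) &
              forall l, (a k < l < e k)%N ->
                q (primal (w k)) < q (ru k l)]].

(* [upd] is the penalty-parameter update.  The constraints of (P~_phi) do not
   depend on phi. *)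
Record master_algorithm (R : realType) n m p (D : cqp R n m p)
    (run : procedure R (n + (m + p)) (m + (m + (p + p))))
    (upd : R -> iterate R n m p -> R)
    (w : nat -> iterate R n m p) (phi : nat -> R) : Prop := MasterAlgorithm {
  MA_init_primal :
    iqp_sfeasible (aug_qp D (phi 0%N)) (primal (w 0%N)) \/
    keeps_feasible run /\ iqp_feasible (aug_qp D (phi 0%N)) (primal (w 0%N));
  MA_init_dual : vle 0 (dual (w 0%N));
  MA_init_phi : 0 < phi 0%N;
  MA_update : forall k, phi k.+1 = upd (phi k) (w k);
  MA_update_ge : forall k, phi k <= phi k.+1;
  MA_inner : inner_iterations D run w phi }.

(** * Explicit form of (P~_phi) *)

Lemma dotv_col_mx (R : realType) d1 d2 (u1 v1 : 'cV[R]_d1) (u2 v2 : 'cV[R]_d2) :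
  dotv (col_mx u1 u2) (col_mx v1 v2) = dotv u1 v1 + dotv u2 v2.
Proof. by rewrite /dotv tr_col_mx mul_row_col mxE. Qed.

Lemma vle_col_mx (R : realType) d1 d2 (u1 v1 : 'cV[R]_d1) (u2 v2 : 'cV[R]_d2) :
  vle (col_mx u1 u2) (col_mx v1 v2) <-> vle u1 v1 /\ vle u2 v2.
Proof.
split=> [h|[h1 h2] i].
  split=> i; first by have := h (lshift d2 i); rewrite !col_mxEu.
  by have := h (rshift d1 i); rewrite !col_mxEd.
by case: (split_ordP i) => j ->; rewrite ?col_mxEu ?col_mxEd.
Qed.

Lemma aug_objE (R : realType) n m p (D : cqp R n m p) (phi : R)
    (w : iterate R n m p) :
  iqp_obj (aug_qp D phi) (primal w) =
  cqp_obj D (ix w) + phi * dotv (ones R (m + p)) (col_mx (iz w) (iy w)).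
Proof.
rewrite /iqp_obj /cqp_obj /quadf /= /primal mul_block_col !mul0mx !addr0.
rewrite !dotv_col_mx addrA {2}/dotv mulmx0 mxE addr0; congr (_ + _).
by rewrite /dotv linearZ /= -scalemxAl mxE.
Qed.

Lemma aug_feasibleE (R : realType) n m p (D : cqp R n m p) (phi : R)
    (w : iterate R n m p) :
  iqp_feasible (aug_qp D phi) (primal w) <->
  [/\ vle (qb D) (qA D *m ix w + iz w), vle 0 (iz w),
      vle (qd D) (qC D *m ix w + iy w) &
      vle (- qd D) (- (qC D *m ix w) + iy w)].
Proof.
rewrite /iqp_feasible /= /primal !mul_col_mx !mul_row_col.
rewrite !mul1mx !mul0mx !mulNmx !addr0 !add0r !vle_col_mx.
by split=> [[? [? []]]|[]].
Qed.

(* Main.v *)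
Require Import Defs.
From mathcomp Require Import all_boot all_order all_algebra.
From mathcomp Require Import all_classical all_reals all_analysis.
From mathcomp Require Import ring lra.
Import Order.TTheory GRing.Theory Num.Theory.
Import numFieldNormedType.Exports.
Set Implicit Arguments.
Unset Strict Implicit.
Unset Printing Implicit Defensive.
Local Open Scope classical_set_scope.
Local Open Scope ring_scope.

(** The penalty is exact because of weak duality, used throughout in one
    approximate form ([approx_weak_duality]): at an iterate [w] with multipliers
    [pi >= 0] and [omega = eta - zeta], for every [x],

      f(ix w) + phi * v(w) <= f(x) - pi^T (A x - b) - omega^T (C x - d) + error,

    where the infeasibility [v] is the sum of the entries of [(z, y)] and the
    error is made of the residuals [G1], [G2], [G3]. The counterpart
    [multiplier_gain_le] bounds the two multiplier terms by the max norm of the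
    multipliers times the infeasibility of any relaxed point over [x].

    The multipliers [(pi0, omega0)] of a dual feasible point give
    [f + M v >= const] on relaxed points, with [M] their max norm. Comparing this
    with the descent of the augmented objective keeps [v] bounded even when
    [phi] blows up ([bounded_aug_vars]). As [pi0 > 0], a relaxed point where [f]
    and [v] are bounded has bounded slacks and a bounded quadratic part, hence is
    itself bounded, as the matrix [H; A; C] is injective ([bounded_level_set]).

    If [phi] were not eventually constant, it would be unbounded, and the update
    rule would provide indices along which the residuals are bounded while the
    multipliers grow like [phi]. Weak duality at a point [x] with [A x > b] and
    [C x = d] bounds [f + pi^T (A x - b)] there, hence [pi], hence the iterates;
    then [C^T omega], and [omega] because [C] has full row rank: a contradiction
    ([penalty_eventually_constant]).

    Once [phi] is constant, the iterates are exactly the record points of a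
    single run ([final_run]) and they are bounded, so that the residuals tend to
    zero; by the update rule, the multipliers then have max norm at most some
    [c < phi] infinitely often. The augmented objective decreases to a limit
    [fstar], and weak duality along these indices gives [fstar <= f + c v] at all
    relaxed points ([limit_final_obj_le]). At the iterates this reads
    [(phi - c) v <= augmented objective - fstar], so that [v] tends to zero and
    [f] to [fstar]; at feasible points it says that [fstar] is a lower bound of
    [f]. By compactness, the iterates approach the solution set. *)

(** * Scalar products, the max norm and arbitrary norms *)

Section Vectors.
Context {R : realType}.
Implicit Types (d e : nat).

Lemma dotvE d (u v : 'cV[R]_d) : dotv u v = \sum_i u i 0 * v i 0.
Proof. by rewrite /dotv mxE; apply: eq_bigr => i _; rewrite mxE. Qed.

Lemma dotvC d (u v : 'cV[R]_d) : dotv u v = dotv v u.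
Proof. by rewrite !dotvE; apply: eq_bigr => i _; rewrite mulrC. Qed.

Lemma dotvDr d (u v w : 'cV[R]_d) : dotv u (v + w) = dotv u v + dotv u w.
Proof. by rewrite /dotv mulmxDr mxE. Qed.

Lemma dotvDl d (u v w : 'cV[R]_d) : dotv (v + w) u = dotv v u + dotv w u.
Proof. by rewrite !(dotvC _ u) dotvDr. Qed.

Lemma dotvNr d (u v : 'cV[R]_d) : dotv u (- v) = - dotv u v.
Proof. by rewrite /dotv mulmxN mxE. Qed.

Lemma dotvNl d (u v : 'cV[R]_d) : dotv (- v) u = - dotv v u.
Proof. by rewrite !(dotvC _ u) dotvNr. Qed.

Lemma dotvZr d a (u v : 'cV[R]_d) : dotv u (a *: v) = a * dotv u v.
Proof. by rewrite /dotv -scalemxAr mxE. Qed.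

Lemma dotvZl d a (u v : 'cV[R]_d) : dotv (a *: v) u = a * dotv v u.
Proof. by rewrite !(dotvC _ u) dotvZr. Qed.

Lemma dotvr0 d (u : 'cV[R]_d) : dotv u 0 = 0.
Proof. by rewrite /dotv mulmx0 mxE. Qed.

Definition dotv_lin := (dotvDl, dotvDr, dotvNl, dotvNr, dotvZl, dotvZr).

Lemma dotv_mulmx d e (A : 'M[R]_(d, e)) (u : 'cV[R]_d) (v : 'cV[R]_e) :
  dotv u (A *m v) = dotv (A^T *m u) v.
Proof. by rewrite /dotv trmx_mul trmxK mulmxA. Qed.

Lemma dotv_dgmx d (u v : 'cV[R]_d) : dotv u v = dotv (ones R d) (dgmx u *m v).
Proof.
by rewrite !dotvE; apply: eq_bigr => i _; rewrite /dgmx mul_diag_mx !mxE mul1r.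
Qed.

Lemma dotv_ge0 d (u v : 'cV[R]_d) : vle 0 u -> vle 0 v -> 0 <= dotv u v.
Proof.
move=> u0 v0; rewrite dotvE; apply: sumr_ge0 => i _.
by have := u0 i; have := v0 i; rewrite mxE => *; rewrite mulr_ge0.
Qed.

Lemma dotv_ones d (u : 'cV[R]_d) : dotv (ones R d) u = \sum_i u i 0.
Proof. by rewrite dotvE; apply: eq_bigr => i _; rewrite mxE mul1r. Qed.

Lemma vlt0W d (u : 'cV[R]_d) : vlt 0 u -> vle 0 u.
Proof. by move=> u0 i; apply: ltW. Qed.

Lemma ones_ge0 d : vle 0 (ones R d).
Proof. by move=> i; rewrite !mxE. Qed.

Lemma norm_coord_le d (u : 'cV[R]_d) i : `|u i 0| <= `|u|.
Proof.
by rewrite [leRHS]/Num.Def.normr /= mx_normrE; apply: (le_bigmax _ _ (i, 0)).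
Qed.

Lemma mx_norm_leP d (u : 'cV[R]_d) (a : R) :
  0 <= a -> (forall i, `|u i 0| <= a) -> `|u| <= a.
Proof.
move=> a0 ua; rewrite [leLHS]/Num.Def.normr /= mx_normrE.
by apply: bigmax_le => // -[i j] _ /=; rewrite ord1.
Qed.

Lemma norm_col_mx_le d e (u : 'cV[R]_d) (v : 'cV[R]_e) :
  `|col_mx u v| <= `|u| + `|v|.
Proof.
apply: mx_norm_leP; first by rewrite addr_ge0.
move=> i; case: (split_ordP i) => j ->; rewrite ?col_mxEu ?col_mxEd.
  by rewrite (le_trans (norm_coord_le _ _)) ?lerDl.
by rewrite (le_trans (norm_coord_le _ _)) ?lerDr.
Qed.

Lemma norm_col_mxu d e (u : 'cV[R]_d) (v : 'cV[R]_e) : `|u| <= `|col_mx u v|.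
Proof.
by apply: mx_norm_leP => // i; rewrite -(col_mxEu u v); apply: norm_coord_le.
Qed.

Lemma norm_col_mxd d e (u : 'cV[R]_d) (v : 'cV[R]_e) : `|v| <= `|col_mx u v|.
Proof.
by apply: mx_norm_leP => // i; rewrite -(col_mxEd u v); apply: norm_coord_le.
Qed.

(** Hölder's inequality for the max norm and its dual, the sum norm; the latter
    enters through bounds on the entries because this is how the variables
    [(z, y)] dominate the constraint violations. *)
Lemma dotv_le_ones d (u v a : 'cV[R]_d) :
  (forall i, `|v i 0| <= a i 0) -> `|dotv u v| <= `|u| * dotv (ones R d) a.
Proof.
move=> va; rewrite !dotvE mulr_sumr (le_trans (ler_norm_sum _ _ _))//.
apply: ler_sum => i _; rewrite mxE mul1r normrM.
by rewrite ler_pM// norm_coord_le.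
Qed.

Lemma norm_dotv_le d (u v : 'cV[R]_d) : `|dotv u v| <= `|u| * (`|v| * d%:R).
Proof.
have -> : `|v| * d%:R = dotv (ones R d) (const_mx `|v|).
  rewrite dotvE (eq_bigr (fun=> `|v|)) ?sumr_const ?card_ord ?mulr_natr//.
  by move=> i _; rewrite !mxE mul1r.
by apply: dotv_le_ones => i; rewrite mxE norm_coord_le.
Qed.

Lemma norm_mulmx_le d e (A : 'M[R]_(d, e)) (v : 'cV[R]_e) :
  `|A *m v| <= (\sum_i `|row i A|) * (`|v| * e%:R).
Proof.
apply: mx_norm_leP => [|i].
  by rewrite mulr_ge0 ?mulr_ge0 ?sumr_ge0.
have -> : (A *m v) i 0 = dotv (row i A)^T v.
  by rewrite dotvE mxE; apply: eq_bigr => j _; rewrite !mxE.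
rewrite (le_trans (norm_dotv_le _ _))// ler_wpM2r ?mulr_ge0//.
apply: (@le_trans _ _ `|row i A|).
  by apply: mx_norm_leP => // j; rewrite mxE [leRHS]/Num.Def.normr /= mx_normrE
     (le_bigmax _ (fun ij : 'I_1 * 'I_e => `|row i A ij.1 ij.2|) (0, j)).
by rewrite (bigD1 i)//= lerDl sumr_ge0.
Qed.

End Vectors.

Section Norms.
Context {R : realType} (nrm : vnorm R).
Implicit Types (d : nat).

Lemma vnorm0 d : nrm d 0 = 0.
Proof. by rewrite -(scale0r (0 : 'cV[R]_d)) vnormZ normr0 mul0r. Qed.

Lemma vnormN d (v : 'cV[R]_d) : nrm d (- v) = nrm d v.
Proof. by rewrite -scaleN1r vnormZ normrN1 mul1r. Qed.

Lemma vnorm_ge0 d (v : 'cV[R]_d) : 0 <= nrm d v.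
Proof.
have := vnormD nrm v (- v); rewrite subrr vnorm0 vnormN; lra.
Qed.

Lemma vnorm_le_mx d :
  exists2 c : R, 0 <= c & forall v : 'cV[R]_d, nrm d v <= c * `|v|.
Proof.
exists (\sum_i nrm d (delta_mx i 0)) => [|v].
  by apply: sumr_ge0 => i _; apply: vnorm_ge0.
have {1}-> : v = \sum_i v i 0 *: delta_mx i 0.
  by rewrite {1}(matrix_sum_delta v); apply: eq_bigr => i _; rewrite big_ord1.
have le_sum (s : seq 'I_d) (F : 'I_d -> 'cV[R]_d) :
    nrm d (\sum_(i <- s) F i) <= \sum_(i <- s) nrm d (F i).
  elim/big_ind2 : _ => // [|x1 x2 y1 y2 h1 h2]; first by rewrite vnorm0.
  by rewrite (le_trans (vnormD _ _ _)) ?lerD.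
rewrite (le_trans (le_sum _ _))// mulr_suml; apply: ler_sum => i _.
by rewrite vnormZ mulrC ler_wpM2l ?vnorm_ge0 ?norm_coord_le.
Qed.

(** Bolzano--Weierstrass, deduced from the compactness of closed balls of row
    vectors by transposition. *)
Lemma bounded_subseq d (x : nat -> 'cV[R]_d) (P : nat -> Prop) (c : R) :
  (forall N, exists2 k, (N <= k)%N & P k) ->
  (forall k, P k -> `|x k| <= c) ->
  exists (l : 'cV[R]_d) (s : nat -> nat),
    [/\ forall j, P (s j), forall j, (j <= s j)%N &
        x \o s @ \oo --> l].
Proof.
move=> Pinf xc.
pose B := [set v : 'rV[R]_d | `|v| <= c].
have Bcpt : compact B.
  apply: bounded_closed_compact.
    by exists c; split; [exact: num_real|move=> M /ltW cM v /le_trans; apply].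
  apply: (@preimage_closed _ _ (fun v : 'rV[R]_d => `|v|) [set y | y <= c]).
    by move=> v _; apply: norm_continuous.
  exact: closed_le.
have norm_tr (v : 'cV[R]_d) : `|v^T| <= `|v|.
  rewrite [leLHS]/Num.Def.normr /= mx_normrE; apply: bigmax_le => // -[i j] _ /=.
  by rewrite !ord1 mxE norm_coord_le.
have norm_trr (v : 'rV[R]_d) : `|v^T| <= `|v|.
  apply: mx_norm_leP => // i; rewrite mxE [leRHS]/Num.Def.normr /= mx_normrE.
  exact: (le_bigmax _ (fun ij : 'I_1 * 'I_d => `|v ij.1 ij.2|) (0, i)).
pose G : set_system 'rV[R]_d := (fun k => (x k)^T) @ within P \oo.
have PF : ProperFilter (within P \oo).
  apply: Build_ProperFilter_ex => // A [N _ NA].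
  by have [k Nk Pk] := Pinf N; exists k; apply: NA.
have [|l [_ lG]] := Bcpt G.
  by exists 0%N => // k _ Pk /=; apply: (le_trans (norm_tr _)); apply: xc.
have ex j : exists k, [/\ P k, (j <= k)%N & `|x k - l^T| <= j.+1%:R^-1].
  have [] := lG [set (x k)^T | k in [set k | P k /\ (j <= k)%N]]
                (ball l (j.+1%:R^-1)).
  - by exists j => // k /= jk Pk; exists k.
  - by apply: nbhsx_ballx; rewrite invr_gt0.
  - move=> _ [[k [Pk jk] <-]]; rewrite mx_norm_ball /ball_ /= => lk.
    exists k; split=> //; rewrite distrC (le_trans _ (ltW lk))//.
    by rewrite -[x k in leLHS]trmxK -linearB/= norm_trr.
have [s sP] := choice ex.
exists l^T, s; split=> [j|j|]; try by have [] := sP j.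
apply/subr_cvg0/norm_cvg0P.
have inv0 : (fun j : nat => j.+1%:R^-1 : R) @ \oo --> (0 : R) := cvg_harmonic.
apply: squeeze_cvgr (cvg_cst 0) inv0.
by near=> j; rewrite normr_ge0; have [] := sP j.
Unshelve. all: by end_near. Qed.

(** All norms are equivalent in finite dimension: otherwise, some points of the
    unit sphere of the max norm, of arbitrarily small norm, would accumulate at
    a nonzero vector of norm zero. *)
Lemma mx_le_vnorm d :
  exists2 c : R, 0 <= c & forall v : 'cV[R]_d, `|v| <= c * nrm d v.
Proof.
have [c1 c10 le1] := vnorm_le_mx d.
apply: contrapT => no.
have ex j : exists v : 'cV[R]_d, `|v| = 1 /\ nrm d v <= j.+1%:R^-1.
  apply: contrapT => nov; apply: no; exists j.+1%:R => // v.
  have [->|v0] := eqVneq v 0; first by rewrite normr0 vnorm0 mulr0.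
  rewrite leNgt; apply/negP => lt; apply: nov; exists (`|v|^-1 *: v).
  have v0' : 0 < `|v| by rewrite normr_gt0.
  rewrite mx_normZ vnormZ !ger0_norm ?invr_ge0 ?mulVf ?gt_eqF//; split=> //.
  by rewrite ler_pdivrMl// ler_pdivlMr ?ltr0n// mulrC ltW.
have [x xP] := choice ex.
have [|k _|l [s [_ sj sl]]] := @bounded_subseq d x (fun=> True) 1.
- by move=> N; exists N.
- by have [->] := xP k.
have l1 : `|l| = 1.
  have sl1 : `|(x \o s) j| @[j --> \oo] --> `|l| by apply: cvg_norm sl.
  have x1 j : `|(x \o s) j| = 1 by have [] := xP (s j).
  apply/eqP; rewrite eq_le (cvgr_to_le sl1) ?(cvgr_to_ge sl1)//.
    by near=> j; rewrite x1.
  by near=> j; rewrite x1.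
have l0 : nrm d l <= 0.
  have inv0 : (fun j : nat => j.+1%:R^-1 : R) @ \oo --> (0 : R) := cvg_harmonic.
  have cv : (fun j => j.+1%:R^-1 + c1 * `|l - (x \o s) j|) @ \oo --> (0 : R).
    rewrite -[X in _ --> X]addr0 -[X in _ --> _ + X](mulr0 c1).
    apply: cvgD inv0 _; apply: cvgM; first exact: cvg_cst.
    have -> : 0 = `|l - l| :> R by rewrite subrr normr0.
    by apply: cvg_norm; apply: cvgB => //; apply: cvg_cst.
  apply: (cvgr_to_ge cv); near=> j.
  rewrite -[l in nrm d l](subrKC ((x \o s) j)) (le_trans (vnormD _ _ _))// lerD//.
  have [_ /le_trans] := xP (s j); apply.
  by rewrite lef_pV2 ?posrE// ler_nat ltnS.
have l00 : l = 0 by apply: (@vnorm_eq0 _ nrm); apply/le_anti; rewrite l0 vnorm_ge0.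
by move: l1; rewrite l00 normr0 => /eqP; rewrite eq_sym oner_eq0.
Unshelve. all: by end_near. Qed.

End Norms.

(** * Bounded families *)

Section Bounded.
Context {R : realType} {I : Type} (K : set I).
Implicit Types (d e : nat).

Lemma boundedP {V : pseudoMetricNormedZmodType R} (f : I -> V) :
  [bounded f k | k in K] <-> exists M : R, forall k, K k -> `|f k| <= M.
Proof.
split=> [[A [_ AK]]|[M fM]].
  by exists (A + 1) => k Kk; apply: (AK (A + 1)) Kk; rewrite ltrDl.
exists M; split; first exact: num_real.
by move=> B MB k Kk; apply: le_trans (fM k Kk) (ltW MB).
Qed.

Lemma bounded_le {V W : pseudoMetricNormedZmodType R} (c : R)
    (f : I -> V) (g : I -> W) :
  0 <= c -> (forall k, K k -> `|g k| <= c * `|f k|) ->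
  [bounded f k | k in K] -> [bounded g k | k in K].
Proof.
move=> c0 gf /boundedP[M fM]; apply/boundedP; exists (c * M) => k Kk.
by rewrite (le_trans (gf k Kk))// ler_wpM2l// fM.
Qed.

Lemma bounded_setT {V : pseudoMetricNormedZmodType R} (f : I -> V) :
  [bounded f k | k in [set: I]] -> [bounded f k | k in K].
Proof. by move=> [A [Areal fA]]; exists A; split=> // B /fA h k _; exact: h. Qed.

Lemma bounded_cst {V : pseudoMetricNormedZmodType R} (a : V) :
  [bounded a | k in K].
Proof. by apply/boundedP; exists `|a|. Qed.

Lemma boundedN {V : pseudoMetricNormedZmodType R} (f : I -> V) :
  [bounded f k | k in K] -> [bounded - f k | k in K].
Proof.
by apply: (@bounded_le _ _ 1) => // k _; rewrite mul1r normrN.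
Qed.

Lemma boundedD {V : pseudoMetricNormedZmodType R} (f g : I -> V) :
  [bounded f k | k in K] -> [bounded g k | k in K] ->
  [bounded f k + g k | k in K].
Proof.
move=> /boundedP[M fM] /boundedP[N gN]; apply/boundedP; exists (M + N) => k Kk.
by rewrite (le_trans (ler_normD _ _))// lerD ?fM ?gN.
Qed.

Lemma boundedM (f g : I -> R) :
  [bounded f k | k in K] -> [bounded g k | k in K] ->
  [bounded f k * g k | k in K].
Proof.
move=> /boundedP[M fM] /boundedP[N gN]; apply/boundedP; exists (M * N) => k Kk.
by rewrite normrM ler_pM ?fM ?gN.
Qed.

Lemma bounded_dotv d (u v : I -> 'cV[R]_d) :
  [bounded u k | k in K] -> [bounded v k | k in K] ->
  [bounded dotv (u k) (v k) | k in K].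
Proof.
move=> /boundedP[M uM] /boundedP[N vN]; apply/boundedP.
exists (M * (N * d%:R)) => k Kk; rewrite (le_trans (norm_dotv_le _ _))//.
by rewrite ler_pM ?mulr_ge0 ?uM// ler_wpM2r ?vN.
Qed.

Lemma bounded_mulmx d e (A : 'M[R]_(d, e)) (u : I -> 'cV[R]_e) :
  [bounded u k | k in K] -> [bounded A *m u k | k in K].
Proof.
apply: (@bounded_le _ _ ((\sum_i `|row i A|) * e%:R)) => [|k _].
  by rewrite mulr_ge0 ?sumr_ge0.
by rewrite (le_trans (norm_mulmx_le _ _))// mulrAC mulrA.
Qed.

Lemma bounded_col_mx d e (u : I -> 'cV[R]_d) (v : I -> 'cV[R]_e) :
  [bounded col_mx (u k) (v k) | k in K] <->
  [bounded u k | k in K] /\ [bounded v k | k in K].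
Proof.
split=> [uv|[/boundedP[M uM] /boundedP[N vN]]].
  split; apply: (bounded_le ler01) uv => k _; rewrite mul1r.
    exact: norm_col_mxu.
  exact: norm_col_mxd.
apply/boundedP; exists (M + N) => k Kk.
by rewrite (le_trans (norm_col_mx_le _ _))// lerD ?uM ?vN.
Qed.

Lemma vnorm_boundedP (nrm : vnorm R) d (u : I -> 'cV[R]_d) :
  [bounded nrm d (u k) | k in K] <-> [bounded u k | k in K].
Proof.
have [c1 c10 le1] := vnorm_le_mx nrm d; have [c2 c20 le2] := mx_le_vnorm nrm d.
split; [apply: (bounded_le c20)|apply: (bounded_le c10)] => k _.
  by rewrite ger0_norm ?vnorm_ge0.
by rewrite ger0_norm ?vnorm_ge0.
Qed.

(** A nonnegative vector is controlled by its scalar product with any positive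
    vector; this is how strict feasibility yields boundedness. *)
Lemma bounded_dotv_pos d (a : 'cV[R]_d) (u : I -> 'cV[R]_d) (M : R) :
  vlt 0 a -> (forall k, K k -> vle 0 (u k)) ->
  (forall k, K k -> dotv a (u k) <= M) -> [bounded u k | k in K].
Proof.
move=> a0 u0 auM; apply/boundedP; exists (\sum_i `|M| / a i 0) => k Kk.
have {}a0 i : 0 < a i 0 by have := a0 i; rewrite mxE.
have {}u0 i : 0 <= u k i 0 by have := u0 _ Kk i; rewrite mxE.
apply: mx_norm_leP => [|i].
  by apply: sumr_ge0 => i _; rewrite divr_ge0// ltW.
rewrite (bigD1 i)//= ler_wpDr//.
  by apply: sumr_ge0 => j _; rewrite divr_ge0// ltW.
rewrite ger0_norm// ler_pdivlMr// (le_trans _ (ler_norm M))//.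
rewrite (le_trans _ (auM _ Kk))// dotvE (bigD1 i)//= mulrC lerDl.
by apply: sumr_ge0 => j _; rewrite mulr_ge0// ltW.
Qed.

End Bounded.

Lemma vnorm_cvg0P {R : realType} (nrm : vnorm R) {I : Type} (F : set_system I)
    {FF : Filter F} d (u : I -> 'cV[R]_d) :
  (fun k => nrm d (u k)) @ F --> (0 : R) <-> u @ F --> (0 : 'cV[R]_d).
Proof.
have [c1 c10 le1] := vnorm_le_mx nrm d; have [c2 c20 le2] := mx_le_vnorm nrm d.
rewrite -(norm_cvg0P u); split=> cv0.
  have cv : (fun k => c2 * nrm d (u k)) @ F --> (0 : R).
    by rewrite -[X in _ --> X](mulr0 c2); apply: cvgM cv0; exact: cvg_cst.
  apply: (squeeze_cvgr _ (cvg_cst 0) cv); apply: nearW => k.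
  by rewrite normr_ge0 le2.
have cv : (fun k => c1 * `|u k|) @ F --> (0 : R).
  by rewrite -[X in _ --> X](mulr0 c1); apply: cvgM cv0; exact: cvg_cst.
apply: (squeeze_cvgr _ (cvg_cst 0) cv); apply: nearW => k.
by rewrite vnorm_ge0 le1.
Qed.

Lemma cvg0_norm_le {R : realType} {I : Type} (F : set_system I) {FF : Filter F}
    {V W : pseudoMetricNormedZmodType R} (f : I -> V) (g : I -> W) :
  f @ F --> (0 : V) -> (forall k, `|g k| <= `|f k|) -> g @ F --> (0 : W).
Proof.
move=> /norm_cvg0P f0 gf; apply/norm_cvg0P.
by apply: (squeeze_cvgr _ (cvg_cst 0) f0); apply: nearW => k; rewrite normr_ge0 gf.
Qed.

Lemma dotv_bounded_cvg0 {R : realType} d (u v : nat -> 'cV[R]_d) (N : nat) :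
  [bounded u k | k in [set k | (N <= k)%N]] -> v @ \oo --> (0 : 'cV[R]_d) ->
  (fun k => dotv (u k) (v k)) @ \oo --> (0 : R).
Proof.
move=> /boundedP[M uM] /norm_cvg0P v0; apply/norm_cvg0P.
have cv : (fun k => M * (`|v k| * d%:R)) @ \oo --> (0 : R).
  rewrite -[X in _ --> X](mulr0 M); apply: cvgM; first exact: cvg_cst.
  by rewrite -[X in _ --> X](mul0r d%:R); apply: cvgM v0 _; exact: cvg_cst.
apply: (squeeze_cvgr _ (cvg_cst 0) cv); exists N => // k Nk /=.
by rewrite normr_ge0 (le_trans (norm_dotv_le _ _))// ler_wpM2r ?mulr_ge0 ?uM.
Qed.

(** * Convex quadratics *)

Section Quadratics.
Context {R : realType} (d : nat) (Q : 'M[R]_d) (g : 'cV[R]_d).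
Hypothesis psdQ : psdmx Q.

Lemma quadf_expand (u v : 'cV[R]_d) :
  quadf Q g v = quadf Q g u + dotv (Q *m u + g) (v - u) +
                2^-1 * dotv (v - u) (Q *m (v - u)).
Proof.
have sym : dotv u (Q *m v) = dotv v (Q *m u).
  by rewrite dotv_mulmx psdQ.1 dotvC.
by rewrite /quadf mulmxBr !dotv_lin !(dotvC (Q *m u)) sym; field.
Qed.

Lemma quadf_above_tangent (u v : 'cV[R]_d) :
  quadf Q g u + dotv (Q *m u + g) (v - u) <= quadf Q g v.
Proof.
by rewrite (quadf_expand u v) lerDl mulr_ge0 ?invr_ge0 ?psdQ.2.
Qed.

(** Positivity of the form at [u + e_i] and [u - e_i], where [e_i] is the
    [i]-th unit vector, bounds the [i]-th entry of [Q *m u]. *)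
Lemma norm_psd_mulmx_coord (u : 'cV[R]_d) i :
  `|(Q *m u) i 0| <= 2^-1 * (dotv u (Q *m u) + Q i i).
Proof.
pose e : 'cV[R]_d := delta_mx i 0.
have eE (v : 'cV[R]_d) : dotv e v = v i 0.
  rewrite dotvE (bigD1 i)//= big1 ?addr0 => [|j ji].
    by rewrite mxE !eqxx mul1r.
  by rewrite mxE (negPf ji) mul0r.
have Qe : dotv e (Q *m e) = Q i i.
  rewrite eE mxE (bigD1 i)//= big1 ?addr0 => [|j ji].
    by rewrite mxE !eqxx mulr1.
  by rewrite mxE (negPf ji) mulr0.
have sym : dotv u (Q *m e) = dotv e (Q *m u).
  by rewrite dotv_mulmx psdQ.1 dotvC.
have := psdQ.2 (u + e); have := psdQ.2 (u - e).
rewrite mulmxBr mulmxDr !dotv_lin sym Qe eE ler_norml => h1 h2.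
by apply/andP; split; lra.
Qed.

Lemma bounded_psd_mulmx {I : Type} (K : set I) (u : I -> 'cV[R]_d) (M : R) :
  (forall k, K k -> dotv (u k) (Q *m u k) <= M) -> [bounded Q *m u k | k in K].
Proof.
move=> uM; apply/boundedP; exists (2^-1 * (`|M| + \sum_i `|Q i i|)) => k Kk.
apply: mx_norm_leP => [|i].
  by rewrite mulr_ge0 ?invr_ge0 ?addr_ge0 ?sumr_ge0.
rewrite (le_trans (norm_psd_mulmx_coord _ _))// ler_wpM2l ?invr_ge0//.
rewrite lerD// ?(le_trans (uM _ Kk)) ?ler_norm//.
by rewrite (bigD1 i)//= ler_wpDr ?ler_norm ?sumr_ge0.
Qed.

End Quadratics.

Section Limits.
Context {R : realType} {I : Type} (F : set_system I) {FF : Filter F}.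

Lemma coord_cvg d (u : I -> 'cV[R]_d) (l : 'cV[R]_d) i :
  u @ F --> l -> (fun k => u k i 0) @ F --> l i 0.
Proof.
move=> ul; apply: (@continuous_cvg _ _ _ _ _ u (fun v => v i 0)) ul.
exact: coord_continuous.
Qed.

Lemma mulmx_coord_cvg d e (A : 'M[R]_(d, e)) (u : I -> 'cV[R]_e) (l : 'cV[R]_e) i :
  u @ F --> l -> (fun k => (A *m u k) i 0) @ F --> (A *m l) i 0.
Proof.
move=> ul.
have -> : (fun k => (A *m u k) i 0) = (fun k => \sum_j A i j * u k j 0).
  by apply/funext => k; rewrite mxE.
rewrite mxE; apply: cvg_big => [|j _]; first exact: add_continuous.
apply: cvgM; first exact: cvg_cst.
exact: coord_cvg.
Qed.

Lemma dotv_cvg d (u v : I -> 'cV[R]_d) (a b : 'cV[R]_d) :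
  (forall i, (fun k => u k i 0) @ F --> a i 0) ->
  (forall i, (fun k => v k i 0) @ F --> b i 0) ->
  (fun k => dotv (u k) (v k)) @ F --> dotv a b.
Proof.
move=> ua vb.
have -> : (fun k => dotv (u k) (v k)) = (fun k => \sum_i u k i 0 * v k i 0).
  by apply/funext => k; rewrite dotvE.
by rewrite dotvE; apply: cvg_big => [|j _];
  [exact: add_continuous|apply: cvgM].
Qed.

Lemma quadf_cvg d (Q : 'M[R]_d) (g : 'cV[R]_d) (u : I -> 'cV[R]_d) (l : 'cV[R]_d) :
  u @ F --> l -> (fun k => quadf Q g (u k)) @ F --> quadf Q g l.
Proof.
move=> ul.
have uli i : (fun k => u k i 0) @ F --> l i 0 by exact: coord_cvg.
apply: cvgD; last by apply: dotv_cvg => // i; exact: cvg_cst.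
apply: cvgM; first exact: cvg_cst.
by apply: dotv_cvg => // i; exact: mulmx_coord_cvg.
Qed.

End Limits.

(** * The relaxed problem: a priori bounds *)

Section Relaxation.
Context {R : realType} (n m p : nat) (D : cqp R n m p).
Implicit Types (w : iterate R n m p) (phi : R).

(** The constraints of the augmented problem do not involve the penalty
    parameter, so that any value, here 0, may be used to state them. *)
Definition relaxed w : Prop := iqp_feasible (aug_qp D 0) (primal w).

Definition infeasibility w : R := dotv (ones R (m + p)) (aug_vars w).

Lemma relaxedP w : relaxed w <->
  [/\ vle (qb D) (qA D *m ix w + iz w), vle 0 (iz w),
      vle (qd D) (qC D *m ix w + iy w) &
      vle (- qd D) (- (qC D *m ix w) + iy w)].
Proof. exact: aug_feasibleE. Qed.

Lemma relaxed_eq_residual w : relaxed w ->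
  forall i, `|(qC D *m ix w - qd D) i 0| <= iy w i 0.
Proof.
move=> /relaxedP[_ _ h1 h2] i; have := h1 i; have := h2 i.
by rewrite !mxE ler_norml => *; apply/andP; split; lra.
Qed.

Lemma relaxed_slack_ge0 w : relaxed w -> vle 0 (slack_s D w).
Proof.
move=> /relaxedP[h _ _ _] i; have := h i.
by rewrite /slack_s !mxE; lra.
Qed.

Lemma aug_vars_ge0 w : relaxed w -> vle 0 (aug_vars w).
Proof.
move=> rw; rewrite /aug_vars -col_mx0; apply/vle_col_mx; split.
  by have /relaxedP[] := rw.
move=> i; rewrite mxE.
exact: le_trans (normr_ge0 _) (relaxed_eq_residual rw i).
Qed.

Lemma infeasibility_ge0 w : relaxed w -> 0 <= infeasibility w.
Proof. by move=> /aug_vars_ge0 a0; apply: dotv_ge0 => //; exact: ones_ge0. Qed.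

Lemma norm_aug_vars_le w : relaxed w -> `|aug_vars w| <= infeasibility w.
Proof.
move=> rw; have a0 i : 0 <= aug_vars w i 0.
  by have := aug_vars_ge0 rw i; rewrite mxE.
apply: mx_norm_leP => [|i]; first exact: infeasibility_ge0.
rewrite ger0_norm// /infeasibility dotv_ones (bigD1 i)//= lerDl.
by apply: sumr_ge0 => j _.
Qed.

(** The multipliers price the violation of the constraints; by Hölder's
    inequality, violating them gains at most the max norm of the multipliers per
    unit of infeasibility. A penalty parameter above this norm is thus exact. *)
Lemma multiplier_gain_le w (pi : 'cV[R]_m) (omega : 'cV[R]_p) :
  relaxed w -> vle 0 pi ->
  - dotv pi (qA D *m ix w - qb D) - dotv omega (qC D *m ix w - qd D) <=
  `|col_mx pi omega| * infeasibility w.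
Proof.
move=> rw pi0.
have : dotv (col_mx pi omega) (col_mx (iz w) (- (qC D *m ix w - qd D))) <=
       `|col_mx pi omega| * infeasibility w.
  rewrite (le_trans (ler_norm _))//; apply: dotv_le_ones => i.
  rewrite /aug_vars; case: (split_ordP i) => j ->; rewrite ?col_mxEu ?col_mxEd.
    have /relaxedP[_ /(_ j) z0 _ _] := rw.
    by rewrite ger0_norm//; move: z0; rewrite mxE.
  by rewrite mxE normrN relaxed_eq_residual.
apply: le_trans; rewrite dotv_col_mx dotvNr lerD2r.
have := dotv_ge0 pi0 (relaxed_slack_ge0 rw).
by rewrite /slack_s !dotv_lin; lra.
Qed.

Hypothesis psdH : psdmx (qH D).

(** Residual of the optimality conditions of the augmented problem, in the form
    in which it bounds the duality gap. *)
Definition gap_residual phi w : R :=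
  G3 D w + dotv (ones R _) (G1 D w) - dotv (dsubmx (G2 D phi w)) (aug_vars w).

(** Weak duality for the augmented problem at an approximate primal-dual
    pair: the convexity inequality at [ix w], in which the gradient is expressed
    with the multipliers, and the slacks are eliminated. *)
Lemma approx_weak_duality phi w (x : 'cV[R]_n) :
  cqp_obj D (ix w) + phi * infeasibility w <=
  cqp_obj D x - dotv (ipi w) (qA D *m x - qb D)
  - dotv (ieta w - izeta w) (qC D *m x - qd D)
  + gap_residual phi w - dotv (lagr_grad D w) x.
Proof.
have := quadf_above_tangent (qc D) psdH (ix w) x; rewrite -!/(cqp_obj D _).
have -> : qH D *m ix w + qc D = lagr_grad D w + (qA D)^T *m ipi w
                                + (qC D)^T *m (ieta w - izeta w).
  by rewrite /lagr_grad addrAC !subrK.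
rewrite /gap_residual /infeasibility /G3 /G1 /G2 /aug_vars col_mxKd.
set r := lagr_grad D w.
have onesE a b : ones R (a + b) = col_mx (ones R a) (ones R b).
  by rewrite /ones col_mx_const.
rewrite !onesE !dotv_col_mx -!dotv_dgmx /slack_s /slack_tp /slack_tm.
rewrite !dotv_lin -!dotv_mulmx !(mulmxBr, dotv_lin).
rewrite !(dotvC (_ *m ix w)) !(dotvC (qb D)) !(dotvC (qd D)) -!(dotvC (iz w)).
rewrite -!(dotvC (iy w)) => h.
lra.
Qed.

Section APrioriBounds.
Variables (x0 : 'cV[R]_n) (pi0 : 'cV[R]_m) (omega0 : 'cV[R]_p).
Hypothesis dual_x0 :
  qH D *m x0 + qc D - (qA D)^T *m pi0 - (qC D)^T *m omega0 = 0.
Hypothesis pi0_gt0 : vlt 0 pi0.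

(** Dual feasibility turns the gradient at [x0] into a combination of the
    constraint normals, so that the tangent part of the expansion at [x0] only
    depends on the constraint functions. *)
Lemma obj_dual_point w :
  cqp_obj D (ix w) =
  cqp_obj D x0 - dotv (qH D *m x0 + qc D) x0
  + dotv pi0 (qA D *m ix w) + dotv omega0 (qC D *m ix w)
  + 2^-1 * dotv (ix w - x0) (qH D *m (ix w - x0)).
Proof.
have grad : dotv (qH D *m x0 + qc D) (ix w) =
    dotv pi0 (qA D *m ix w) + dotv omega0 (qC D *m ix w).
  rewrite !dotv_mulmx -dotvDl; congr dotv.
  by apply/eqP; rewrite -subr_eq0 opprD addrA dual_x0.
rewrite {1}/cqp_obj (quadf_expand (qc D) psdH x0) -/(cqp_obj D _).
by rewrite dotvDr dotvNr grad; ring.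
Qed.

(** The objective may be unbounded below over infeasible points; adding the
    infeasibility, weighted by the dual multipliers, compensates for this. *)
Lemma penalized_obj_lb w : relaxed w ->
  cqp_obj D x0 - dotv (qH D *m x0 + qc D) x0
    + dotv pi0 (qb D) + dotv omega0 (qd D) <=
  cqp_obj D (ix w) + `|col_mx pi0 omega0| * infeasibility w.
Proof.
move=> rw; have := multiplier_gain_le omega0 rw (vlt0W pi0_gt0).
have := psdH.2 (ix w - x0); rewrite (obj_dual_point w) !dotvDr !dotvNr.
by move: (dotv _ _) => q; lra.
Qed.

Hypothesis HAC_full : \rank (col_mx (qH D) (col_mx (qA D) (qC D))) = n.

(** The level sets of the objective over the points of bounded infeasibility
    are bounded: the quadratic part and the slacks are both bounded by the
    duality gap to a dual point with positive multipliers, and [H; A; C] is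
    injective. *)
Lemma bounded_level_set {I : Type} (K : set I) (w : I -> iterate R n m p) M :
  (forall k, K k -> relaxed (w k)) ->
  (forall k, K k -> cqp_obj D (ix (w k)) <= M) ->
  [bounded aug_vars (w k) | k in K] -> [bounded ix (w k) | k in K].
Proof.
move=> rw fM /bounded_col_mx[bz by_].
have bC : [bounded qC D *m ix (w k) | k in K].
  have -> : (fun k => qC D *m ix (w k)) =
            (fun k => (qC D *m ix (w k) - qd D) + qd D).
    by apply/funext => k; rewrite subrK.
  apply: boundedD (bounded_cst _ _); apply: (bounded_le ler01) by_ => k Kk.
  rewrite mul1r; apply: mx_norm_leP => // i.
  rewrite (le_trans (relaxed_eq_residual (rw _ Kk) _))//.
  by rewrite (le_trans (ler_norm _)) ?norm_coord_le.
pose q k := dotv (ix (w k) - x0) (qH D *m (ix (w k) - x0)).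
have q0 k : 0 <= q k by exact: psdH.2.
have [B qB] : exists B, forall k, K k ->
    dotv pi0 (slack_s D (w k)) + 2^-1 * q k <= B.
  have /boundedP[B1 b1] := bounded_dotv (bounded_cst K pi0) bz.
  have /boundedP[B2 b2] := bounded_dotv (bounded_cst K omega0) bC.
  exists (M - (cqp_obj D x0 - dotv (qH D *m x0 + qc D) x0
    + dotv pi0 (qb D)) + B1 + B2) => k Kk.
  have := fM _ Kk; rewrite obj_dual_point -/(q k).
  have := ler_normlP _ _ (b1 _ Kk) => -[_]; have := ler_normlP _ _ (b2 _ Kk) => -[].
  rewrite /slack_s !dotvDr dotvNr; lra.
have s0 k : K k -> vle 0 (slack_s D (w k)).
  by move=> Kk; apply: relaxed_slack_ge0; exact: rw.
have bA : [bounded qA D *m ix (w k) | k in K].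
  have -> : (fun k => qA D *m ix (w k)) =
            (fun k => slack_s D (w k) + (qb D - iz (w k))).
    by apply/funext => k; rewrite /slack_s addrA subrK addrK.
  apply: boundedD; last by apply: boundedD (bounded_cst _ _) (boundedN bz).
  apply: (bounded_dotv_pos pi0_gt0 s0 (M := B)) => k Kk.
  by rewrite (le_trans _ (qB _ Kk))// lerDl mulr_ge0// invr_ge0.
have bH : [bounded qH D *m ix (w k) | k in K].
  have -> : (fun k => qH D *m ix (w k)) =
            (fun k => qH D *m (ix (w k) - x0) + qH D *m x0).
    by apply/funext => k; rewrite mulmxBr subrK.
  apply: boundedD (bounded_cst _ _).
  apply: (bounded_psd_mulmx psdH (M := 2 * B)) => k Kk; rewrite -/(q k).
  have := dotv_ge0 (vlt0W pi0_gt0) (s0 _ Kk); have := qB _ Kk; lra.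
have /row_fullP[L LE] : row_full (col_mx (qH D) (col_mx (qA D) (qC D))).
  by rewrite /row_full HAC_full.
have -> : (fun k => ix (w k)) = (fun k => L *m col_mx (qH D *m ix (w k))
    (col_mx (qA D *m ix (w k)) (qC D *m ix (w k)))).
  by apply/funext => k; rewrite -!mul_col_mx mulmxA LE mul1mx.
by apply: bounded_mulmx; rewrite !bounded_col_mx.
Qed.
End APrioriBounds.
End Relaxation.

(** * Sequences generated by the master algorithm *)

Section Master.
Context {R : realType} (nrm : vnorm R) (n m p : nat) (D : cqp R n m p).
Hypothesis psdH : psdmx (qH D).
Context (run : procedure R (n + (m + p)) (m + (m + (p + p)))).
Hypothesis hrun : base_iteration nrm run.
Context (upd : R -> iterate R n m p -> R).
Context (w : nat -> iterate R n m p) (phi : nat -> R).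
Hypothesis hMA : master_algorithm D run upd w phi.

Lemma psd_aug phi' : psdmx (iqpQ (aug_qp D phi')).
Proof.
split=> [|u] /=; first by rewrite tr_block_mx !trmx0 psdH.1.
rewrite -(vsubmxK u) mul_block_col !mul0mx !addr0 dotv_col_mx.
by rewrite {2}/dotv mulmx0 mxE addr0 psdH.2.
Qed.

(** A property of the points of a run that is stable under the base iteration
    holds at all iterates, since these lie on runs that start at iterates. *)
Lemma master_invariant (P : 'cV[R]_(n + (m + p)) -> Prop) :
  P (primal (w 0%N)) ->
  (forall phi' u lam, run (aug_qp D phi') u lam ->
    forall l, P (u l) -> P (u l.+1)) ->
  forall k, P (primal (w k)).
Proof.
move=> P0 PS; case: (MA_inner hMA) => ru [rl] [a] [e] [hru _ _ _ he].
elim=> // k Pk; have [ae ua [ue _] _ _] := he k.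
rewrite -ue -(subnKC (ltnW ae)); elim: (e k - a k)%N => [|j IH].
  by rewrite addn0 ua.
by rewrite addnS; apply: PS IH; exact: hru.
Qed.

Lemma master_relaxed k : relaxed D (w k).
Proof.
have sf u : iqp_sfeasible (aug_qp D 0) u -> iqp_feasible (aug_qp D 0) u.
  by move=> h i; apply: ltW; exact: h.
have keepsP : keeps_feasible run -> relaxed D (w 0%N) ->
    forall k, relaxed D (w k).
  move=> kf r0; apply: (master_invariant (P := iqp_feasible (aug_qp D 0))) => //.
  by move=> phi' u lam hu l; apply: (kf _ _ _ (psd_aug phi') hu).
case: (MA_init_primal hMA) => [s0|[kf r0]]; last exact: keepsP.
case: (BI1 hrun) => [kf|ks]; first by apply: keepsP => //; apply: sf; exact: s0.
apply: sf; apply: (master_invariant (P := iqp_sfeasible (aug_qp D 0))) => //.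
by move=> phi' u lam hu l; apply: (ks _ _ _ (psd_aug phi') hu).
Qed.

Lemma master_dual_ge0 k : vle 0 (dual (w k)).
Proof.
case: k => [|k]; first exact: MA_init_dual hMA.
case: (MA_inner hMA) => ru [rl] [a] [e] [hru _ _ _ /(_ k)[_ _ [_ <-] _ _]].
exact: (BI_dual hrun (psd_aug _) (hru k)).
Qed.

Lemma master_ipi_ge0 k : vle 0 (ipi (w k)).
Proof.
move=> i; have := master_dual_ge0 k (lshift _ i).
by rewrite /dual col_mxEu !mxE.
Qed.

Lemma master_descent k :
  cqp_obj D (ix (w k.+1)) + phi k.+1 * infeasibility (w k.+1) <=
  cqp_obj D (ix (w k)) + phi k.+1 * infeasibility (w k).
Proof.
case: (MA_inner hMA) => ru [rl] [a] [e] [_ _ _ _ /(_ k)[_ _ _ + _]].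
by rewrite !aug_objE.
Qed.

Section Penalty.
Hypothesis hD : standing_assumptions nrm D.
Hypothesis hPU : penalty_requirements nrm D w phi.

(** Once the penalty parameter exceeds the size of the multipliers of a dual
    feasible point, the potential [(f + M v - c) / (phi - M) + v] is
    nonincreasing and bounds the infeasibility [v]; hence the infeasibility
    cannot blow up even if the penalty parameter does. *)
Lemma bounded_aug_vars : [bounded aug_vars (w k) | k in [set: nat]].
Proof.
apply: contrapT => unb.
have phioo : phi @ \oo --> +oo.
  by apply: (PU2 hPU) => /vnorm_boundedP.
case: (dual_sfeasible hD) => x0 [pi0 [om0 [dx0 pi0_gt0]]].
have lb k := penalized_obj_lb psdH dx0 pi0_gt0 (master_relaxed k).
set M := `|_| in lb; set c := (X in forall k, X <= _) in lb.
have /cvgryPgt/(_ M)[N _ phiM] := phioo.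
pose F k := cqp_obj D (ix (w k)) + M * infeasibility (w k) - c.
have F0 k : 0 <= F k by rewrite subr_ge0.
have psi0 k : (N <= k)%N -> 0 < phi k - M by move=> Nk; rewrite subr_gt0 phiM.
pose G k := F k / (phi k - M) + infeasibility (w k).
have GS k : (N <= k)%N -> G k.+1 <= G k.
  move=> Nk; have psik := psi0 _ Nk; have psiS := psi0 _ (leqW Nk).
  apply: (@le_trans _ _ (F k / (phi k.+1 - M) + infeasibility (w k))).
    rewrite -(ler_pM2r psiS) !(mulrDl (_ / _)) !divfK ?gt_eqF//.
    by have := master_descent k; rewrite /F; lra.
  rewrite lerD2r ler_wpM2l// lef_pV2 ?posrE//.
  by rewrite lerD2r (MA_update_ge hMA).
have GN j : G (N + j)%N <= G N.
  elim: j => [|j IH]; first by rewrite addn0.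
  by rewrite addnS (le_trans (GS _ _))// leq_addr.
apply: unb; apply/boundedP.
(* The sum accounts for the iterates before [N]. *)
exists (G N + \sum_(k < N) infeasibility (w k)) => k _.
rewrite (le_trans (norm_aug_vars_le (master_relaxed k)))//.
have v0 j : 0 <= infeasibility (w j) := infeasibility_ge0 (master_relaxed j).
have GN0 : 0 <= G N by rewrite addr_ge0 ?divr_ge0 ?(ltW (psi0 _ _)).
have [Nk|kN] := leqP N k.
  rewrite ler_wpDr ?sumr_ge0// -(subnKC Nk).
  apply: le_trans (GN (k - N)%N).
  by rewrite lerDr divr_ge0 //; exact/ltW/psi0/leq_addr.
by rewrite (bigD1 (Ordinal kN))//= addrCA lerDl addr_ge0 ?sumr_ge0.
Qed.

Lemma bounded_infeasibility : [bounded infeasibility (w k) | k in [set: nat]].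
Proof. exact: bounded_dotv (bounded_cst _ _) bounded_aug_vars. Qed.

(** If the penalty parameter grew without bound, weak duality against a point
    at which the inequality constraints are strict would bound, along the
    indices provided by the update rule, first the multipliers of these and the
    objective, then the primal iterates, and finally, as [C] is surjective, the
    multipliers of the equalities; but the update rule makes the multipliers
    grow at least like the penalty parameter. *)
Lemma penalty_eventually_constant :
  exists phihat : R, \forall k \near \oo, phi k = phihat.
Proof.
have [_ _ [//|phioo]] := PU1 hPU; exfalso.
have vb : [bounded nrm _ (aug_vars (w k)) | k in [set: nat]].
  by apply/vnorm_boundedP; exact: bounded_aug_vars.
have [K [Kinf [/vnorm_boundedP b1 /vnorm_boundedP b2 b3 bphi]]] :=
  PU4 hPU phioo vb.
have bz : [bounded aug_vars (w k) | k in K] := bounded_setT K bounded_aug_vars.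
have /bounded_col_mx[br b2'] := b2.
have bgap : [bounded gap_residual D (phi k) (w k) | k in K].
  apply: boundedD; last apply: boundedN.
    by apply: boundedD b3 _; apply: bounded_dotv b1; exact: bounded_cst.
  by apply: bounded_dotv bz; under eq_fun do rewrite col_mxKd.
case: (primal_sfeasible hD) => xb [Axb Cxb].
pose s := qA D *m xb - qb D.
have s0 : vlt 0 s by move=> i; have := Axb i; rewrite !mxE subr_gt0.
have v0 k : 0 <= infeasibility (w k) := infeasibility_ge0 (master_relaxed k).
have phi0 : forall k, 0 < phi k by have [] := PU1 hPU.
have [B wd] : exists B, forall k, K k ->
    cqp_obj D (ix (w k)) + dotv (ipi (w k)) s <= B.
  have /boundedP[B1 gB] := bgap.
  have /boundedP[B2 rB] := bounded_dotv br (bounded_cst K xb).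
  exists (cqp_obj D xb + B1 + B2) => k Kk.
  have := approx_weak_duality psdH (phi k) (w k) xb.
  rewrite Cxb subrr dotvr0 subr0 -/s.
  have := ler_normlP _ _ (gB _ Kk) => -[_]; have := ler_normlP _ _ (rB _ Kk) => -[].
  have := mulr_ge0 (ltW (phi0 k)) (v0 k); lra.
case: (dual_sfeasible hD) => x0 [pi0 [om0 [dx0 pi0_gt0]]].
have [B' pis] : exists B', forall k, K k -> dotv s (ipi (w k)) <= B'.
  have /boundedP[B1 vB] := boundedM (bounded_cst K `|col_mx pi0 om0|)
                                   (bounded_setT K bounded_infeasibility).
  have lb k := penalized_obj_lb psdH dx0 pi0_gt0 (master_relaxed k).
  set c := (X in forall k, X <= _) in lb; exists (B - c + B1) => k Kk.
  have := lb k; have := ler_normlP _ _ (vB _ Kk) => -[_]; have := wd _ Kk.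
  by rewrite dotvC; lra.
have bpi : [bounded ipi (w k) | k in K].
  by apply: (bounded_dotv_pos s0 _ pis) => k _; exact: master_ipi_ge0.
have bx : [bounded ix (w k) | k in K].
  apply: (bounded_level_set psdH dx0 pi0_gt0 (HAC_full_col_rank hD) (M := B)) => //.
    by move=> k _; exact: master_relaxed.
  move=> k Kk; rewrite (le_trans _ (wd _ Kk))// lerDl.
  by apply: dotv_ge0; [exact: master_ipi_ge0|exact: vlt0W].
have bom : [bounded ieta (w k) - izeta (w k) | k in K].
  have /row_freeP[B'' BE] : row_free (qC D).
    by rewrite /row_free (C_full_row_rank hD).
  have -> : (fun k => ieta (w k) - izeta (w k)) = (fun k => B''^T *m
      (qH D *m ix (w k) + qc D - (qA D)^T *m ipi (w k) - lagr_grad D (w k))).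
    apply/funext => k; rewrite /lagr_grad opprB subrKC.
    by rewrite mulmxA -trmx_mul BE trmx1 mul1mx.
  apply: bounded_mulmx; apply: boundedD (boundedN br).
  apply: boundedD; last by apply: boundedN; exact: bounded_mulmx.
  by apply: boundedD (bounded_cst _ _); exact: bounded_mulmx.
have /vnorm_boundedP - /(_ nrm) /boundedP[N1 mulN] :
    [bounded multipliers (w k) | k in K] by apply/bounded_col_mx.
have /boundedP[N2 phiN] := bphi.
have [N _ Nphi] := (cvgryPgt phi).1 phioo (`|N2| * Num.max 1 N1).
(* An index of [K] large enough for [phi] to exceed the bound implied by that
   on the multipliers. *)
have [k Nk Kk] : exists2 k, (N <= k)%N & K k.
  apply: contrapT => no; apply: Kinf; apply: (sub_finite_set _ (finite_II N)).
  by move=> k Kk; rewrite /= ltnNge; apply/negP => Nk; apply: no; exists k.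
have := Nphi _ Nk; rewrite /= ltNge => /negP; apply.
have M0 : 0 < Num.max 1 (nrm _ (multipliers (w k))) by rewrite lt_max ltr01.
have := phiN _ Kk; rewrite ger0_norm ?divr_ge0 ?(ltW M0) ?(ltW (phi0 _))//.
rewrite ler_pdivrMr// => /le_trans; apply.
apply: (@le_trans _ _ (`|N2| * Num.max 1 (nrm _ (multipliers (w k))))).
  by rewrite ler_wpM2r ?(ltW M0) ?ler_norm.
rewrite ler_wpM2l// ge_max le_max lexx/= le_max (le_trans _ (mulN _ Kk)) ?orbT//.
exact: ler_norm.
Qed.

End Penalty.
End Master.

(** * The run for the final penalty parameter *)

Section KKT.
Context {R : realType} (n m p : nat) (D : cqp R n m p).
Implicit Types (w : iterate R n m p) (phi : R).

Lemma dgmx_col_mx d e (a c : 'cV[R]_d) (b f : 'cV[R]_e) :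
  dgmx (col_mx a b) *m col_mx c f = col_mx (dgmx a *m c) (dgmx b *m f).
Proof.
apply/matrixP => i j; rewrite /dgmx mul_diag_mx mxE [_^T _ _]mxE.
by case: (split_ordP i) => k ->;
  rewrite ?col_mxEu ?col_mxEd mul_diag_mx !mxE.
Qed.

Lemma aug_complementarity phi w :
  dgmx (iqp_slack (aug_qp D phi) (primal w)) *m dual w = G1 D w.
Proof.
rewrite /iqp_slack /= /primal !mul_col_mx !mul_row_col !mul1mx !mul0mx.
rewrite !addr0 !add0r !opp_col_mx !add_col_mx !dgmx_col_mx.
by rewrite /G1 /slack_s /slack_tp /slack_tm oppr0 addr0 opprK mulNmx.
Qed.

Lemma aug_gradient phi w :
  iqpQ (aug_qp D phi) *m primal w + iqpg (aug_qp D phi) -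
    (iqpM (aug_qp D phi))^T *m dual w =
  col_mx (lagr_grad D w) (- dsubmx (G2 D phi w)).
Proof.
rewrite /= /primal /dual /G2 /lagr_grad col_mxKd mul_block_col !mul0mx !addr0.
rewrite !tr_col_mx !tr_row_mx !mul_row_col !mul_col_mx !trmx0 !trmx1.
rewrite !mul0mx !mul1mx linearN /= !mulNmx.
rewrite !add_col_mx !opp_col_mx !add_col_mx !add0r !addr0.
have -> : phi *: ones R (m + p) = col_mx (phi *: ones R m) (phi *: ones R p).
  by rewrite -scale_col_mx /ones col_mx_const.
rewrite add_col_mx mulmxBr !opprD !opprK !addrA.
by rewrite !(addrC _ (phi *: _)) !addrA.
Qed.

Lemma norm_G2_le phi w :
  `|G2 D phi w| <= `|col_mx (lagr_grad D w) (- dsubmx (G2 D phi w))|.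
Proof.
rewrite -[G2 D phi w in leLHS]vsubmxK {1}/G2 col_mxKu.
set r := lagr_grad D w; set g := dsubmx _.
apply: mx_norm_leP => // i; case: (split_ordP i) => j ->.
  by rewrite col_mxEu (le_trans (norm_coord_le _ _))// norm_col_mxu.
rewrite col_mxEd (le_trans (norm_coord_le _ _))// -normrN.
exact: norm_col_mxd.
Qed.

End KKT.

Section FinalRun.
Context {R : realType} (nrm : vnorm R) (n m p : nat) (D : cqp R n m p).
Hypothesis psdH : psdmx (qH D).
Context (run : procedure R (n + (m + p)) (m + (m + (p + p)))).
Hypothesis hrun : base_iteration nrm run.
Context (upd : R -> iterate R n m p -> R).
Context (w : nat -> iterate R n m p) (phi : nat -> R).
Hypothesis hMA : master_algorithm D run upd w phi.
Context (phihat : R).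
Hypothesis phi_const : \forall k \near \oo, phi k = phihat.

(** The iterates computed with the final penalty parameter are the record points of
    a single run, from its start on: an inner iteration stops at the first point
    that is not worse than the current iterate. *)
Lemma final_run : exists u lam (idx : nat -> nat) k0,
  [/\ run (aug_qp D phihat) u lam,
      forall k, (k0 <= k)%N -> phi k.+1 = phihat,
      forall k, (k0 <= k)%N -> (idx k < idx k.+1)%N,
      forall k, (k0 < k)%N -> u (idx k) = primal (w k) /\ lam (idx k) = dual (w k) &
      record_indices (aug_qp D phihat) u = [set idx k | k in [set k | (k0 < k)%N]]].
Proof.
case: (MA_inner hMA) => ru [rl] [a] [e] [hru a0 aS aN he].
(* A run that is started when the penalty parameter takes its final value, or
   at the very beginning. *)
have [k0 [ak0 phiE]] : exists k0, a k0 = 0%N /\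
    forall k, (k0 <= k)%N -> phi k.+1 = phihat.
  have [N _ phiN] := phi_const.
  have {phiN} : forall k, (N <= k)%N -> phi k.+1 = phihat.
    by move=> k Nk; apply: phiN; exact: leqW.
  elim: N => [phiN|N IH phiN]; first by exists 0%N.
  have [E|NE] := eqVneq (phi N.+1) phihat.
    by apply: IH => k; rewrite leq_eqVlt => /predU1P[<-//|]; exact: phiN.
  exists N.+1; split=> //; apply: aN; rewrite (phiN _ (leqnn _)).
  by apply/eqP; rewrite eq_sym.
have same k : (k0 <= k)%N -> [/\ ru k = ru k0, rl k = rl k0 & a k.+1 = e k].
  move=> /subnKC <-; elim: (k - k0)%N => [|j [IHu IHl IHa]].
    by rewrite addn0; split=> //; have [] := aS k0; rewrite ?phiE.
  have [] := aS (k0 + j)%N; first by rewrite !phiE ?leqW ?leq_addr.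
  move=> E1 E2 E3; rewrite addnS E1 E2; split=> //.
  by have [] := aS (k0 + j).+1; rewrite ?phiE// ?leqW// ?leqW// leq_addr.
exists (ru k0), (rl k0), a, k0; split=> //.
- by rewrite -(phiE k0).
- by move=> k kk; have [_ _ ->] := same _ kk; have [] := he k.
- case=> // k kk; have [E1 E2 ->] := same _ kk.
  by have [_ _ [h1 h2] _ _] := he k; rewrite -E1 -E2.
pose q := iqp_obj (aug_qp D phihat).
have stepE k : (k0 <= k)%N ->
    [/\ (a k < a k.+1)%N, ru k0 (a k) = primal (w k),
        ru k0 (a k.+1) = primal (w k.+1),
        q (ru k0 (a k.+1)) <= q (ru k0 (a k)) &
        forall l, (a k < l < a k.+1)%N -> q (ru k0 (a k)) < q (ru k0 l)].
  move=> kk; have [E1 _ ->] := same _ kk; have := he k.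
  by rewrite phiE// E1 -/q => -[h1 h2 [h3 _] h4 h5]; rewrite h2 h3.
have recE k : (k0 <= k)%N -> forall l, (l <= a k)%N ->
    q (ru k0 (a k)) <= q (ru k0 l).
  move=> /subnKC <-; elim: (k - k0)%N => [|j IH] l.
    by rewrite addn0 ak0 leqn0 => /eqP->.
  have [_ _ _ d1 d2] := stepE _ (leq_addr j k0).
  rewrite addnS leq_eqVlt => /predU1P[->//|lt].
  rewrite (le_trans d1)//; have [/IH//|alt] := leqP l (a (k0 + j)%N).
  by rewrite ltW// d2// alt.
apply/seteqP; split=> [l [l0 lrec]|_ [k /= kk <-]].
  have [N lN] : exists N, (l <= a (k0 + N))%N.
    exists l; elim: l {l0 lrec} => // j IH.
    have [lt _ _ _ _] := stepE _ (leq_addr j k0).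
    by rewrite addnS (leq_ltn_trans IH).
  elim: N lN => [|N IH]; first by rewrite addn0 ak0 leqNgt l0.
  have [_ _ _ _ d2] := stepE _ (leq_addr N k0).
  rewrite addnS leq_eqVlt => /predU1P[->|lt].
    by exists (k0 + N).+1 => //=; rewrite ltnS leq_addr.
  have [/IH//|alt] := leqP l (a (k0 + N)%N).
  have := d2 l; rewrite alt lt => /(_ isT); rewrite ltNge.
  by rewrite [X in ~~ X]lrec.
split; last by move=> l /ltnW; apply: recE; exact: ltnW.
case: k kk => // k kk.
by have [lt _ _ _ _] := stepE k kk; apply: leq_ltn_trans lt.
Qed.

Definition final_obj k : R :=
  cqp_obj D (ix (w k)) + phihat * infeasibility (w k).

Lemma final_obj_nonincreasing N :
  (forall k, (N <= k)%N -> phi k.+1 = phihat) ->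
  forall k, (N <= k)%N -> final_obj k.+1 <= final_obj k.
Proof.
by move=> phiN k Nk; have := master_descent hMA k; rewrite phiN.
Qed.

Hypothesis hD : standing_assumptions nrm D.
Hypothesis hPU : penalty_requirements nrm D w phi.

Lemma phihat_gt0 : 0 < phihat.
Proof.
have [N _ phiN] := phi_const; rewrite -(phiN N) //=.
by have [] := PU1 hPU.
Qed.

Lemma bounded_ix : exists N, [/\ forall k, (N <= k)%N -> phi k.+1 = phihat &
  [bounded ix (w k) | k in [set k | (N <= k)%N]]].
Proof.
have [N _ phiN] := phi_const; exists N.
have {}phiN k : (N <= k)%N -> phi k.+1 = phihat.
  by move=> Nk; apply: phiN; exact: leqW.
split=> //; case: (dual_sfeasible hD) => x0 [pi0 [om0 [dx0 pi0_gt0]]].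
apply: (bounded_level_set psdH dx0 pi0_gt0 (HAC_full_col_rank hD)
          (M := final_obj N)) => [k _|k /= Nk|].
- exact: (master_relaxed psdH hrun hMA).
- apply: (@le_trans _ _ (final_obj k)).
    rewrite lerDl mulr_ge0 ?(ltW phihat_gt0)//.
    exact: infeasibility_ge0 (master_relaxed psdH hrun hMA k).
  move: Nk => /subnKC <-; elim: (k - N)%N => [|j IH]; first by rewrite addn0.
  rewrite addnS (le_trans _ IH)//.
  by rewrite (final_obj_nonincreasing phiN)// leq_addr.
- exact: bounded_setT _ (bounded_aug_vars psdH hrun hMA hD hPU).
Qed.

(** The points of the final run at its record indices are bounded, hence the
    optimality residuals of the augmented problem vanish. *)
Lemma residuals_vanish :
  [/\ (fun k => G1 D (w k)) @ \oo --> (0 : 'cV[R]__),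
      (fun k => G2 D (phi k) (w k)) @ \oo --> (0 : 'cV[R]__) &
      (fun k => G3 D (w k)) @ \oo --> (0 : R)].
Proof.
have [u [lam [idx [k0 [hu phiE idxS uE recE]]]]] := final_run.
have [N [_ bx]] := bounded_ix.
have bw : [bounded primal (w k) | k in [set k | (N <= k)%N]].
  apply/bounded_col_mx; split=> //.
  exact: bounded_setT _ (bounded_aug_vars psdH hrun hMA hD hPU).
have brec : [bounded nrm _ (u k) | k in record_indices (aug_qp D phihat) u].
  apply/vnorm_boundedP/boundedP; rewrite recE.
  have /boundedP[B wB] := bw.
  exists (`|B| + \sum_(k < N) `|primal (w k)|) => _ [k kk <-].
  rewrite (uE _ kk).1; have [Nk|kN] := leqP N k.
    by rewrite (le_trans (wB _ Nk))// (le_trans (ler_norm _))// lerDl sumr_ge0.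
  by rewrite (bigD1 (Ordinal kN))//= addrCA lerDl addr_ge0 ?sumr_ge0.
have kkt := BI3 hrun (psd_aug psdH _) hu brec.
have idx_ge k : (k0 <= k)%N -> (k - k0 <= idx k)%N.
  move=> /subnKC {2}<-; elim: (k - k0)%N => [|j IH] //.
  by rewrite addnS (leq_ltn_trans IH)// idxS ?leq_addr.
have idxoo : idx @ \oo --> within (record_indices (aug_qp D phihat) u) \oo.
  move=> A [M _ MA]; exists (k0.+1 + M)%N => // k /= kM.
  have kk : (k0 < k)%N by rewrite (leq_trans _ kM)// leq_addr.
  apply: MA => /=.
    rewrite (leq_trans _ (idx_ge _ (ltnW kk)))// leq_subRL ?(ltnW kk)//.
    by rewrite (leq_trans _ kM)// leq_add2r.
  by rewrite recE; exists k.
have res0 : (fun k => kkt_residual nrm (aug_qp D phihat) (primal (w k)) (dual (w k)))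
    @ \oo --> (0 : R).
  have := cvg_comp _ _ idxoo kkt; apply: cvg_trans; apply: near_eq_cvg.
  by exists k0.+1 => // k /= kk; have [-> ->] := uE _ kk.
have g1 : (fun k => G1 D (w k)) @ \oo --> (0 : 'cV[R]__).
  apply/(vnorm_cvg0P nrm); apply: (squeeze_cvgr _ (cvg_cst 0) res0).
  apply: nearW => k; rewrite vnorm_ge0 /kkt_residual aug_complementarity.
  by rewrite le_max lexx.
pose g k := col_mx (lagr_grad D (w k)) (- dsubmx (G2 D phihat (w k))).
have g0 : g @ \oo --> (0 : 'cV[R]__).
  apply/(vnorm_cvg0P nrm); apply: (squeeze_cvgr _ (cvg_cst 0) res0).
  apply: nearW => k; rewrite vnorm_ge0 /kkt_residual aug_gradient.
  by rewrite le_max lexx orbT.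
split=> //.
  apply/norm_cvg0P; have /norm_cvg0P ng0 := g0.
  apply: (squeeze_cvgr _ (cvg_cst 0) ng0).
  have [M _ phiM] := phi_const; exists M => // k Mk /=.
  by rewrite normr_ge0 phiM//= norm_G2_le.
have r0 : (fun k => lagr_grad D (w k)) @ \oo --> (0 : 'cV[R]__).
  apply/norm_cvg0P; have /norm_cvg0P ng0 := g0.
  apply: (squeeze_cvgr _ (cvg_cst 0) ng0); apply: nearW => k.
  by rewrite normr_ge0 norm_col_mxu.
have := dotv_bounded_cvg0 bx r0.
by under eq_cvg do rewrite dotvC; apply.
Qed.

End FinalRun.

(** * Convergence *)

(** The limit inferior is the supremum of the infima of the tails, so that any
    number above it exceeds some term of every tail. *)
Lemma limn_einf_lt_frequently {R : realType} (f : nat -> R) (b : R) :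
  (limn_einf (fun k => (f k)%:E) < b%:E)%E ->
  exists2 c, c < b & forall N, exists2 k, (N <= k)%N & f k <= c.
Proof.
move=> lt.
have [c [cb lc]] : exists c, c < b /\ (limn_einf (fun k => (f k)%:E) < c%:E)%E.
  move: lt; case: (limn_einf _) => [r| |] //.
    rewrite lte_fin => rb; exists ((r + b) / 2).
    by rewrite lte_fin; split; lra.
  by exists (b - 1); split; [lra|rewrite ltNyr].
exists c => // N.
have : (ereal_inf (sdrop (fun k => (f k)%:E) N) < c%:E)%E.
  apply: le_lt_trans lc; rewrite limn_einf_lim (cvg_lim _ (@cvg_einfs_sup R _))//.
  by apply: ereal_sup_ubound; exists N.
move=> /ereal_inf_lt[_ [k /= Nk <-]]; rewrite lte_fin => fk.
by exists k => //; exact: ltW.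
Qed.

Section Convergence.
Context {R : realType} (nrm : vnorm R) (n m p : nat) (D : cqp R n m p).
Hypothesis psdH : psdmx (qH D).
Context (run : procedure R (n + (m + p)) (m + (m + (p + p)))).
Hypothesis hrun : base_iteration nrm run.
Context (upd : R -> iterate R n m p -> R).
Context (w : nat -> iterate R n m p) (phi : nat -> R).
Hypothesis hMA : master_algorithm D run upd w phi.
Context (phihat : R).
Hypothesis phi_const : \forall k \near \oo, phi k = phihat.
Hypothesis hD : standing_assumptions nrm D.
Hypothesis hPU : penalty_requirements nrm D w phi.

Let wrelaxed := master_relaxed psdH hrun hMA.
Let F := final_obj D w phihat.

(** Exactness of the penalty: along the iterates whose multipliers stay below
    [c < phihat], approximate weak duality against a relaxed point passes to the
    limit. *)
Lemma limit_final_obj_le : exists fstar c : R, [/\ F @ \oo --> fstar,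
    c < phihat & forall w', relaxed D w' ->
      fstar <= cqp_obj D (ix w') + c * infeasibility w'].
Proof.
have [g1 g2 g3] := residuals_vanish psdH hrun hMA phi_const hD hPU.
have bz := bounded_aug_vars psdH hrun hMA hD hPU.
have [N0 [phiE _]] := bounded_ix psdH hrun hMA phi_const hD hPU.
have [c cphi freq] : exists2 c, c < phihat &
    forall N, exists2 k, (N <= k)%N & `|multipliers (w k)| <= c.
  apply: limn_einf_lt_frequently; apply: (PU3 hPU phi_const).
  - exact/vnorm_cvg0P.
  - exact/vnorm_cvg0P.
  - exact/norm_cvg0P.
have [fstar Fstar] : exists fstar : R, F @ \oo --> fstar.
  have : cvgn (fun j => F (j + N0)%N).
    apply: nonincreasing_is_cvgn.
      apply/nonincreasing_seqP => j.
      exact: (final_obj_nonincreasing hMA phiE (leq_addl _ _)).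
    case: (dual_sfeasible hD) => x0 [pi0 [om0 [dx0 pi0_gt0]]].
    have lb k := penalized_obj_lb psdH dx0 pi0_gt0 (wrelaxed k).
    set M := `|_| in lb; set b := (X in forall k, X <= _) in lb.
    have /boundedP[B vB] := boundedM (bounded_cst _ (phihat - M))
      (bounded_infeasibility psdH hrun hMA hD hPU).
    exists (b - B) => _ [j _ <-]; have := lb (j + N0)%N.
    have := ler_normlP _ _ (vB (j + N0)%N I) => -[h1 h2].
    by rewrite /F /final_obj; lra.
  by move=> /cvg_ex[l]; rewrite cvg_shiftn; exists l.
exists fstar, c; split=> // w' rw'.
have r0 : (fun k => lagr_grad D (w k)) @ \oo --> (0 : 'cV[R]__).
  apply: (cvg0_norm_le g2) => k; exact: norm_col_mxu.
have d0 : (fun k => dsubmx (G2 D (phi k) (w k))) @ \oo --> (0 : 'cV[R]__).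
  apply: (cvg0_norm_le g2) => k.
  by rewrite -[leRHS](congr1 _ (vsubmxK _)) norm_col_mxd.
pose err k := gap_residual D (phi k) (w k) - dotv (lagr_grad D (w k)) (ix w').
have err0 : err @ \oo --> (0 : R).
  have e1 := @dotv_bounded_cvg0 _ _ _ _ 0 (bounded_cst _ (ones R _)) g1.
  have e2 := @dotv_bounded_cvg0 _ _ _ _ 0 (bounded_setT _ bz) d0.
  have e3 := @dotv_bounded_cvg0 _ _ _ _ 0 (bounded_cst _ (ix w')) r0.
  have := cvgB (cvgB (cvgD g3 e1) e2) e3; rewrite addr0 !subr0.
  rewrite (_ : err = (fun k => G3 D (w k)) \+ (fun k => dotv (ones R _) (G1 D (w k)))
    \- (fun k => dotv (aug_vars (w k)) (dsubmx (G2 D (phi k) (w k))))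
    \- (fun k => dotv (ix w') (lagr_grad D (w k)))); first by apply.
  by apply/funext => k; rewrite /err/= (dotvC (ix w')) (dotvC (aug_vars _)).
apply/ler_addgt0Pr => /= e e0.
have e20 : 0 < e / 2 by rewrite divr_gt0.
have /cvgr0Pnorm_le/(_ _ e20)[N1 _ errN] := err0.
have /subr_cvg0/cvgr0Pnorm_le/(_ _ e20)[N2 _ FN] := Fstar.
have [N3 _ phiN] := phi_const.
have [k] := freq (maxn N1 (maxn N2 N3)); rewrite !geq_max => /and3P[k1 k2 k3] mc.
have := approx_weak_duality psdH (phi k) (w k) (ix w').
rewrite (phiN k k3).
have := multiplier_gain_le (ieta (w k) - izeta (w k)) rw'
          (master_ipi_ge0 psdH hrun hMA k).
have := ler_wpM2r (infeasibility_ge0 rw') mc.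
have := ler_normlP _ _ (errN k k1) => -[_]; rewrite /err (phiN k k3).
have := ler_normlP _ _ (FN k k2) => -[+ _]; rewrite /multipliers.
rewrite /F /final_obj; lra.
Qed.

Lemma aug_vars_and_obj_cvg : exists fstar : R,
  [/\ (fun k => infeasibility (w k)) @ \oo --> (0 : R),
      (fun k => cqp_obj D (ix (w k))) @ \oo --> fstar &
      forall x, iqp_feasible (split_qp D) x -> fstar <= cqp_obj D x].
Proof.
have [fstar [c [Fstar cphi Fle]]] := limit_final_obj_le.
have pc : 0 < phihat - c by rewrite subr_gt0.
have v0 : (fun k => infeasibility (w k)) @ \oo --> (0 : R).
  have cv : (fun k => (phihat - c)^-1 * (F k - fstar)) @ \oo --> (0 : R).
    rewrite -[X in _ --> X](mulr0 (phihat - c)^-1).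
    by apply: cvgM; [exact: cvg_cst|apply/subr_cvg0].
  apply: (squeeze_cvgr _ (cvg_cst 0) cv); apply: nearW => k.
  rewrite (infeasibility_ge0 (wrelaxed k)) ler_pdivlMl//.
  by have := Fle _ (wrelaxed k); rewrite /F /final_obj; lra.
exists fstar; split=> // [|x xfeas].
  have -> : (fun k => cqp_obj D (ix (w k))) =
            F \- (fun k => phihat * infeasibility (w k)).
    by apply/funext => k; rewrite /= /F /final_obj addrK.
  rewrite -[X in _ --> X]subr0 -[X in _ --> _ - X](mulr0 phihat).
  by apply: cvgB Fstar _; apply: cvgM => //; exact: cvg_cst.
pose w' : iterate R n m p := Iterate x 0 0 0 0 0 0.
have v'0 : infeasibility w' = 0 by rewrite /infeasibility /aug_vars/= col_mx0 dotvr0.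
have := Fle w'; rewrite v'0 mulr0 addr0; apply; apply/relaxedP => /=.
move: xfeas; rewrite /iqp_feasible /= !mul_col_mx !mulNmx !vle_col_mx.
by rewrite !addr0 => -[? [? ?]]; split.
Qed.

(** Otherwise a subsequence would stay away from the solution set; but it has a
    limit point, which is feasible since the infeasibility vanishes, and optimal
    since its objective value [fstar] is a lower bound. *)
Lemma near_solution_set (e : R) : 0 < e ->
  \forall k \near \oo, exists2 s, iqp_sol (split_qp D) s & nrm n (ix (w k) - s) < e.
Proof.
move=> e0; have [fstar [v0 fx fle]] := aug_vars_and_obj_cvg.
have [N0 [_ /boundedP[B xB]]] := bounded_ix psdH hrun hMA phi_const hD hPU.
apply: contrapT => far.
pose P k := (N0 <= k)%N /\
  ~ exists2 s, iqp_sol (split_qp D) s & nrm n (ix (w k) - s) < e.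
have Pinf N : exists2 k, (N <= k)%N & P k.
  apply: contrapT => no; apply: far; exists (maxn N N0) => // k /=.
  rewrite geq_max => /andP[Nk N0k]; apply: contrapT => nk; apply: no.
  by exists k.
have [|l [s [sP sj sl]]] := bounded_subseq Pinf (x := fun k => ix (w k)) (c := B).
  by move=> k [N0k _]; exact: xB.
have soo : s @ \oo --> \oo.
  by move=> A [N _ NA]; exists N => // j /= Nj; apply: NA; exact: leq_trans (sj j).
have vs0 : (fun j => infeasibility (w (s j))) @ \oo --> (0 : R).
  exact: cvg_comp soo v0.
have lfeas : iqp_feasible (split_qp D) l.
  have lim_ge (q : nat) (M : 'M[R]_(q, n)) (b : 'cV[R]_q) :
      (forall k i, b i 0 <= (M *m ix (w k)) i 0 + infeasibility (w k)) ->
      vle b (M *m l).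
    move=> bM i; rewrite -[leRHS]addr0.
    have cv : (fun j => (M *m ix (w (s j))) i 0 + infeasibility (w (s j))) @ \oo
        --> (M *m l) i 0 + 0.
      by apply: cvgD vs0; apply: mulmx_coord_cvg sl.
    by apply: (cvgr_to_ge cv); apply: nearW => j; exact: bM.
  have vle_inf k := norm_aug_vars_le (wrelaxed k).
  rewrite /iqp_feasible /= !mul_col_mx !vle_col_mx.
  split; [|split]; apply: lim_ge => k i; have /relaxedP[h1 h2 h3 h4] := wrelaxed k.
  - have := h1 i; rewrite mxE => /le_trans; apply; rewrite lerD2l.
    rewrite (le_trans (ler_norm _))// (le_trans (norm_coord_le _ _))//.
    by rewrite (le_trans _ (vle_inf k))// norm_col_mxu.
  - have := h3 i; rewrite mxE => /le_trans; apply; rewrite lerD2l.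
    rewrite (le_trans (ler_norm _))// (le_trans (norm_coord_le _ _))//.
    by rewrite (le_trans _ (vle_inf k))// norm_col_mxd.
  - have := h4 i; rewrite mulNmx => /le_trans; apply; rewrite [leLHS]mxE lerD2l.
    rewrite (le_trans (ler_norm _))// (le_trans (norm_coord_le _ _))//.
    by rewrite (le_trans _ (vle_inf k))// norm_col_mxd.
have fl : cqp_obj D l <= fstar.
  have fs : (fun j => cqp_obj D (ix (w (s j)))) @ \oo --> fstar.
    exact: cvg_comp soo fx.
  have fl : (fun j => cqp_obj D (ix (w (s j)))) @ \oo --> cqp_obj D l.
    exact: quadf_cvg sl.
  by apply: (ler_cvg_to fl fs); exact: nearW.
have lsol : iqp_sol (split_qp D) l by split=> // x /fle; exact: le_trans.
have d0 : (fun j => nrm n (ix (w (s j)) - l)) @ \oo --> (0 : R).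
  by apply/vnorm_cvg0P/subr_cvg0.
have /cvgr0Pnorm_lt/(_ _ e0)[N _ Ne] := d0.
have [_] := sP N; apply; exists l => //.
by rewrite (le_lt_trans (ler_norm _))//; apply: Ne => /=.
Qed.

Lemma vdist_ge0 d (x : 'cV[R]_d) A : (0 <= vdist nrm x A)%E.
Proof. by apply/ereal_infP => _ [s _ <-]; rewrite lee_fin vnorm_ge0. Qed.

Lemma vdist_solution_set_cvg0 :
  (fun k => vdist nrm (ix (w k)) (iqp_sol (split_qp D))) @ \oo --> 0%E.
Proof.
have le_e (e : R) : 0 < e -> \forall k \near \oo,
    (vdist nrm (ix (w k)) (iqp_sol (split_qp D)) <= e%:E)%E.
  move=> e0; apply: filterS (near_solution_set e0) => k [s ssol sk].
  apply: (@le_trans _ _ (nrm n (ix (w k) - s))%:E); last by rewrite lee_fin ltW.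
  by apply: ereal_inf_lbound; exists s.
apply/fine_cvgP; split.
  apply: filterS (le_e 1 ltr01) => k k1.
  rewrite ge0_fin_numE ?vdist_ge0//.
  exact: le_lt_trans k1 (ltry _).
apply/cvgr0Pnorm_le => e e0; apply: filterS (le_e e e0) => k ke /=.
rewrite ger0_norm ?fine_ge0 ?vdist_ge0// -lee_fin fineK//.
rewrite ge0_fin_numE ?vdist_ge0//.
exact: le_lt_trans ke (ltry _).
Qed.

End Convergence.

Unset Implicit Arguments.
Set Strict Implicit.

Theorem theorem4p7 (R : realType) (nrm : vnorm R) (n m p : nat)
    (hpn : (p <= n)%N) (hmp : (0 < m + p)%N)
    (D : cqp R n m p) (hH : psdmx (qH D))
    (hD : standing_assumptions nrm D)
    (run : procedure R (n + (m + p)) (m + (m + (p + p))))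
    (hrun : base_iteration nrm run)
    (upd : R -> iterate R n m p -> R)
    (w : nat -> iterate R n m p) (phi : nat -> R)
    (hMA : master_algorithm D run upd w phi)
    (hPU : penalty_requirements nrm D w phi) :
  (exists phihat : R, \forall k \near \oo, phi k = phihat) /\
  ((fun k => nrm (m + p)%N (aug_vars (w k))) @ \oo --> (0 : R) /\
   (fun k => vdist nrm (ix (w k)) (iqp_sol (split_qp D))) @ \oo --> 0%E).
Proof.
have [phihat phi_const] := penalty_eventually_constant hH hrun hMA hD hPU.
split; first by exists phihat.
have [_ [v0 _ _]] := aug_vars_and_obj_cvg hH hrun hMA phi_const hD hPU.
split; last exact: (vdist_solution_set_cvg0 hH hrun hMA phi_const hD hPU).
apply/vnorm_cvg0P; apply: (cvg0_norm_le v0) => k.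
rewrite (le_trans _ (ler_norm _))//.
exact: norm_aug_vars_le (master_relaxed hH hrun hMA k).
Qed.
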